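(* Let $I\subseteq\mathbb{R}$ be either $(a,b)$, $(a,b]$, $[a,b)$ or $[a,b]$, where $-\infty\le a<b\le\infty$, let $\lambda: I\to\mathbb{C}$ be continuous, let $\mu$ be a continuous function on $I$ that is (real-valued and) nonnegative on $I$, and let $t_0\in(a,b)$. Consider the system $$\bm{x}'=A(t)\bm{x},\qquad A(t)=\begin{pmatrix}\lambda(t)&\mu(t)\\0&\lambda(t)\end{pmatrix}.\qquad (\ast)$$ Then the following hold. (i) If $\kappa_{21}(t):=\int_t^b\left(1+\left|\int_t^s\mu(\tau)d\tau\right|\right)e^{-\int_t^s\Re(\lambda(\tau))d\tau}ds$ exists for all $t\in I$, $\sup_{t\in I}\kappa_{21}(t)<\infty$, and $\lim_{t\to b-0}\int_{t_0}^t\Re(\lambda(s))ds=\infty$, then $(\ast)$ is Ulam stable on $I$, and the best Ulam constant is $K_{21}=\sup_{t\in I}\kappa_{21}(t)$. (ii) If $\kappa_{22}(t):=\int_a^t\left(1+\left|\int_s^t\mu(\tau)d\tau\right|\right)e^{\int_s^t\Re(\lambda(\tau))d\tau}ds$ exists for all $t\in I$, $\sup_{t\in I}\kappa_{22}(t)<\infty$, and $\lim_{t\to a+0}\int_t^{t_0}\Re(\lambda(s))ds=-\infty$, then $(\ast)$ is Ulam stable on $I$, and the best Ulam constant is $K_{22}=\sup_{t\in I}\kappa_{22}(t)$.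
   Context: $\|(v_1,v_2)^T\|_\infty=\max\{|v_1|,|v_2|\}$ on $\mathbb{C}^2$, and $\Re(z)$ is the real part of $z$. The integrals defining the $\kappa$'s are possibly improper, and ''exists'' means that they converge. For continuous $A: I\to\mathbb{C}^{2\times2}$, the equation $\bm{x}'=A(t)\bm{x}$ is called Ulam stable on $I$ if there is a constant $K>0$ such that: for every $\varepsilon>0$ and every continuously differentiable $\bm{\phi}: I\to\mathbb{C}^2$ with $\sup_{t\in I}\|\bm{\phi}'(t)-A(t)\bm{\phi}(t)\|_\infty\le\varepsilon$, there exists a solution $\bm{x}: I\to\mathbb{C}^2$ of the equation with $\sup_{t\in I}\|\bm{\phi}(t)-\bm{x}(t)\|_\infty\le K\varepsilon$. Any such $K$ is called an Ulam constant for the equation on $I$. The best Ulam constant is the minimum of all Ulam constants, if this minimum exists. *)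

(* Defs.v *)
From Stdlib Require Import Reals.
From Coquelicot Require Import Coquelicot.
Open Scope R_scope.

(** Functions on an interval [I] are total functions on [R]; every notion below
    only depends on their values on [I]. *)

(** [lc] and [rc] say whether the left and the right endpoints are included.
    As [t] is real, including an infinite endpoint changes nothing. *)
Definition interval (lc rc : bool) (a b : Rbar) (t : R) : Prop :=
  (if lc then Rbar_le a t else Rbar_lt a t) /\
  (if rc then Rbar_le t b else Rbar_lt t b).

(** [t -> b - 0] and [t -> a + 0], for finite or infinite [b] and [a]. *)
Definition to_left (b : Rbar) : (R -> Prop) -> Prop :=
  within (fun t : R => Rbar_lt t b) (Rbar_locally b).

Definition to_right (a : Rbar) : (R -> Prop) -> Prop :=
  within (fun t : R => Rbar_lt a t) (Rbar_locally a).

Definition sup_on (I : R -> Prop) (f : R -> R) : Rbar :=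
  Lub_Rbar (fun y => exists t, I t /\ y = f t).

(** [C^2] as a real normed module. Its library norm is Euclidean, hence
    equivalent to [norm_inf], and is only used to define derivatives. *)
Definition C2 : NormedModule R_AbsRing :=
  prod_NormedModule R_AbsRing C_R_NormedModule C_R_NormedModule.

Definition norm_inf (v : C2) : R := Rmax (Cmod (fst v)) (Cmod (snd v)).

Definition mat2_apply (A : @matrix C 2 2) (v : C2) : C2 :=
  let c := coeff_mat (RtoC 0) A in
  ((c 0%nat 0%nat * fst v + c 0%nat 1%nat * snd v)%C,
   (c 1%nat 0%nat * fst v + c 1%nat 1%nat * snd v)%C).

(** [is_derive] with the neighbourhoods of [t] restricted to [I], i.e. one-sided
    at the endpoints belonging to [I]. *)
Definition is_derive_within (I : R -> Prop) (f : R -> C2) (t : R) (l : C2) : Prop :=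
  @filterdiff R_AbsRing R_NormedModule C2 f
    (within I (locally t)) (fun h : R => @scal R_AbsRing C2 h l).

Definition is_solution (I : R -> Prop) (A : R -> @matrix C 2 2) (x : R -> C2) : Prop :=
  forall t, I t -> is_derive_within I x t (mat2_apply (A t) (x t)).

Definition is_Ulam_constant (I : R -> Prop) (A : R -> @matrix C 2 2) (K : R) : Prop :=
  0 < K /\
  forall (eps : R) (phi dphi : R -> C2),
    0 < eps ->
    (forall t, I t -> is_derive_within I phi t (dphi t)) ->
    continuous_on I dphi ->
    Rbar_le
      (sup_on I (fun t => norm_inf (minus (dphi t) (mat2_apply (A t) (phi t)))))
      eps ->
    exists x : R -> C2,
      is_solution I A x /\
      Rbar_le (sup_on I (fun t => norm_inf (minus (phi t) (x t)))) (K * eps).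

Definition Ulam_stable (I : R -> Prop) (A : R -> @matrix C 2 2) : Prop :=
  exists K : R, is_Ulam_constant I A K.

Definition is_best_Ulam_constant (I : R -> Prop) (A : R -> @matrix C 2 2) (K : R) : Prop :=
  is_Ulam_constant I A K /\ forall K', is_Ulam_constant I A K' -> K <= K'.

Definition jordan_matrix (lambda : R -> C) (mu : R -> R) (t : R) : @matrix C 2 2 :=
  [ [ lambda t, RtoC (mu t) ], [ RtoC 0, lambda t ] ].

Definition kappa21_integrand (lambda : R -> C) (mu : R -> R) (t s : R) : R :=
  (1 + Rabs (RInt mu t s)) * exp (- RInt (fun tau => Re (lambda tau)) t s).

Definition kappa22_integrand (lambda : R -> C) (mu : R -> R) (t s : R) : R :=
  (1 + Rabs (RInt mu s t)) * exp (RInt (fun tau => Re (lambda tau)) s t).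

Definition kappa21 (b : Rbar) (lambda : R -> C) (mu : R -> R) (t : R) : R :=
  RInt_gen (kappa21_integrand lambda mu t) (at_point t) (to_left b).

Definition kappa22 (a : Rbar) (lambda : R -> C) (mu : R -> R) (t : R) : R :=
  RInt_gen (kappa22_integrand lambda mu t) (to_right a) (at_point t).

(* Main.v *)
(** Put [Lam = int lambda] and [M = int mu], both from [t0], so that
    [X = e^Lam [[1, M], [0, 1]]] is a fundamental matrix.  If [phi' - A phi = r] with
    [|r| <= eps], then [(X^{-1} phi)' = X^{-1} r], and the improper integral defining
    [kappa21] dominates the increments of [X^{-1} phi], which therefore has a limit [c] at [b].
    The solution [x = X c] satisfies [phi - x = - int_t^b X(t) X(s)^{-1} r(s) ds], of norm at most
    [eps * kappa21(t)].  Conversely, for [r = e^{i Im Lam} (1, -1)] this bound is an equality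
    because [mu >= 0], and no other solution stays within bounded distance of [phi] because
    [Re Lam -> +oo] at [b].  Part (ii) is part (i) after the change of variables
    [z(t) = (x1(-t), -x2(-t))].

    One-sided derivatives at endpoints belonging to the interval are turned into ordinary
    ones by extending functions affinely beyond such endpoints. *)
Require Import Defs.
From Stdlib Require Import Reals Lra.
From Coquelicot Require Import Coquelicot.
Open Scope R_scope.

(** * Calculus of complex-valued functions of a real variable *)

(** The weight in [kappa21] is the operator norm, for [norm_inf], of X(t) X(s)^{-1} = e^{Lam(t) -
    Lam(s)} [[1, M(t) - M(s)], [0, 1]], that is, its largest row sum of moduli. For s >= t the entry
    M(t) - M(s) is nonpositive, so a perturbation whose entries have modulus 1 makes the first row
    add up without cancellation when these entries have opposite signs; the factor e^{i Im Lam}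
    removes the phase of e^{-Lam}. Then X^{-1} r = e^{-Re Lam} (1 + M, -1) is real, and the lower
    bound becomes a statement about two real primitives [P] and [Q].

    The obstacle there is the first component. A solution X c within bounded distance of X (P, Q)
    forces Q - Re c2 to be O(e^{-Re Lam}), but M may be unbounded at b, so decay alone does not
    dispose of M (Q - Re c2). The monotonicity of [Q] and the nonnegativity of the kernel take the
    place of that estimate.

    Together the two directions say that the Ulam constants are exactly the positive upper bounds of
    kappa, whence the minimum is the supremum. *)

Definition cexp (z : C) : C := (exp (Re z) * cos (Im z), exp (Re z) * sin (Im z)).

Lemma Cmod_cexp (z : C) : Cmod (cexp z) = exp (Re z).
Proof.
  unfold cexp, Cmod; simpl fst; simpl snd.
  replace (_ + _) with (exp (Re z) ^ 2 * ((sin (Im z))² + (cos (Im z))²))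
    by (unfold Rsqr; ring).
  rewrite sin2_cos2, Rmult_1_r.
  apply sqrt_pow2, Rlt_le, exp_pos.
Qed.

Lemma cexp_opp_r (z : C) : (cexp z * cexp (- z) = 1)%C.
Proof.
  destruct z as [x y]; unfold cexp, Cmult, Copp, RtoC, Re, Im; simpl fst; simpl snd.
  rewrite cos_neg, sin_neg.
  assert (E : exp x * exp (- x) = 1) by (rewrite <- exp_plus, Rplus_opp_r; apply exp_0).
  assert (S := sin2_cos2 y); unfold Rsqr in S.
  f_equal.
  - replace (_ - _) with (exp x * exp (- x) * (sin y * sin y + cos y * cos y)) by ring.
    rewrite E, S; ring.
  - ring.
Qed.

Lemma cexp_0 : cexp 0 = RtoC 1.
Proof.
  unfold cexp, RtoC, Re, Im; simpl fst; simpl snd.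
  rewrite exp_0, cos_0, sin_0; f_equal; ring.
Qed.

Lemma norm_C_R (z : C) : @norm R_AbsRing C_R_NormedModule z = Cmod z.
Proof.
  unfold norm; simpl; unfold prod_norm, Cmod, norm; simpl; unfold abs; simpl.
  f_equal.
  rewrite !Rmult_1_r, <- !Rabs_mult.
  rewrite !Rabs_pos_eq by apply Rle_0_sqr; reflexivity.
Qed.

Lemma is_derive_pair {U V : NormedModule R_AbsRing} (f : R -> U) (g : R -> V) (t : R)
    (df : U) (dg : V) :
  is_derive f t df -> is_derive g t dg ->
  @is_derive R_AbsRing (prod_NormedModule R_AbsRing U V) (fun u => (f u, g u)) t (df, dg).
Proof.
  intros Hf Hg.
  apply (@filterdiff_comp'_2 R_AbsRing R_NormedModule U V (prod_NormedModule R_AbsRing U V)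
           f g pair t _ _ pair Hf Hg).
  apply filterdiff_linear, is_linear_prod; [apply is_linear_fst | apply is_linear_snd].
Qed.

Lemma is_derive_fst {U V : NormedModule R_AbsRing}
    (f : R -> prod_NormedModule R_AbsRing U V) (t : R) (df : prod_NormedModule R_AbsRing U V) :
  is_derive f t df -> is_derive (fun u => fst (f u)) t (fst df).
Proof.
  intros Hf.
  apply (@filterdiff_comp' R_AbsRing R_NormedModule (prod_NormedModule R_AbsRing U V) U
           f fst t _ fst Hf).
  apply filterdiff_linear, is_linear_fst.
Qed.

Lemma is_derive_snd {U V : NormedModule R_AbsRing}
    (f : R -> prod_NormedModule R_AbsRing U V) (t : R) (df : prod_NormedModule R_AbsRing U V) :
  is_derive f t df -> is_derive (fun u => snd (f u)) t (snd df).
Proof.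
  intros Hf.
  apply (@filterdiff_comp' R_AbsRing R_NormedModule (prod_NormedModule R_AbsRing U V) V
           f snd t _ snd Hf).
  apply filterdiff_linear, is_linear_snd.
Qed.

Lemma continuous_pair {U V : UniformSpace} (f : R -> U) (g : R -> V) (t : R) :
  continuous f t -> continuous g t ->
  @continuous R_UniformSpace (prod_UniformSpace U V) (fun u => (f u, g u)) t.
Proof.
  intros Hf Hg.
  apply filterlim_locally; intros eps.
  generalize (filter_and _ _ (proj1 (filterlim_locally f (f t)) Hf eps)
                (proj1 (filterlim_locally g (g t)) Hg eps)).
  apply filter_imp; intros u [Hu Hv]; split; assumption.
Qed.

Notation is_derive_C := (@is_derive R_AbsRing C_R_NormedModule).
Notation continuous_C := (@continuous R_UniformSpace C_UniformSpace).

Lemma is_derive_C_comp (f : R -> C) (t : R) (df : C) :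
  is_derive_C f t df <->
  is_derive (fun u => Re (f u)) t (Re df) /\ is_derive (fun u => Im (f u)) t (Im df).
Proof.
  split.
  - intros H; split; [apply (is_derive_fst f t df H) | apply (is_derive_snd f t df H)].
  - intros [H1 H2].
    apply (is_derive_ext (fun u => (Re (f u), Im (f u)) : C_R_NormedModule)).
    + intros u; symmetry; apply surjective_pairing.
    + rewrite (surjective_pairing df); apply (is_derive_pair _ _ _ _ _ H1 H2).
Qed.

Lemma continuous_C_comp (f : R -> C) (t : R) :
  continuous_C f t <->
  continuous (fun u => Re (f u)) t /\ continuous (fun u => Im (f u)) t.
Proof.
  split.
  - intros H; split.
    + apply (continuous_comp f fst); [exact H |].
      destruct (f t); apply continuous_fst.
    + apply (continuous_comp f snd); [exact H |].
      destruct (f t); apply continuous_snd.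
  - intros [H1 H2].
    apply (continuous_ext (fun u => (Re (f u), Im (f u)))).
    + intros u; symmetry; apply surjective_pairing.
    + apply continuous_pair; assumption.
Qed.

Lemma continuous_C_of_derive (f : R -> C) (t : R) (df : C) :
  is_derive_C f t df -> continuous_C f t.
Proof.
  intros H; apply (@ex_derive_continuous R_AbsRing C_R_NormedModule); exists df; exact H.
Qed.

Lemma is_derive_Cplus (f g : R -> C) (t : R) (df dg : C) :
  is_derive_C f t df -> is_derive_C g t dg ->
  is_derive_C (fun u => (f u + g u)%C) t (df + dg)%C.
Proof. apply (@is_derive_plus R_AbsRing C_R_NormedModule). Qed.

Lemma is_derive_Cminus (f g : R -> C) (t : R) (df dg : C) :
  is_derive_C f t df -> is_derive_C g t dg ->
  is_derive_C (fun u => (f u - g u)%C) t (df - dg)%C.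
Proof. apply (@is_derive_minus R_AbsRing C_R_NormedModule). Qed.

Lemma is_derive_Copp (f : R -> C) (t : R) (df : C) :
  is_derive_C f t df -> is_derive_C (fun u => (- f u)%C) t (- df)%C.
Proof. apply (@is_derive_opp R_AbsRing C_R_NormedModule). Qed.

Lemma is_derive_Cconst (c : C) (t : R) : is_derive_C (fun _ => c) t (RtoC 0).
Proof. apply (@is_derive_const R_AbsRing C_R_NormedModule). Qed.

Lemma is_derive_RtoC (f : R -> R) (t df : R) :
  is_derive f t df -> is_derive_C (fun u => RtoC (f u)) t (RtoC df).
Proof.
  intros H; apply is_derive_C_comp; split; [exact H | exact (is_derive_const (V := R_NormedModule) 0 t)].
Qed.

Lemma is_derive_value {V : NormedModule R_AbsRing} (f : R -> V) (t : R) (df dg : V) :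
  is_derive f t df -> df = dg -> is_derive f t dg.
Proof. intros H <-; exact H. Qed.

Lemma is_derive_C_value (f : R -> C) (t : R) (df dg : C) :
  is_derive_C f t df -> df = dg -> is_derive_C f t dg.
Proof. apply (is_derive_value (V := C_R_NormedModule)). Qed.

Lemma is_derive_Cmult (f g : R -> C) (t : R) (df dg : C) :
  is_derive_C f t df -> is_derive_C g t dg ->
  is_derive_C (fun u => (f u * g u)%C) t (df * g t + f t * dg)%C.
Proof.
  rewrite !is_derive_C_comp; intros [f1 f2] [g1 g2]; split.
  - eapply is_derive_value.
    + exact (is_derive_minus _ _ _ _ _ (Derive.is_derive_mult _ _ _ _ _ f1 g1)
               (Derive.is_derive_mult _ _ _ _ _ f2 g2)).
    + unfold minus, plus, opp, Re, Im; simpl; ring.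
  - eapply is_derive_value.
    + exact (is_derive_plus _ _ _ _ _ (Derive.is_derive_mult _ _ _ _ _ f1 g2)
               (Derive.is_derive_mult _ _ _ _ _ f2 g1)).
    + unfold plus, Re, Im; simpl; ring.
Qed.

Lemma is_derive_cexp (f : R -> C) (t : R) (df : C) :
  is_derive_C f t df -> is_derive_C (fun u => cexp (f u)) t (df * cexp (f t))%C.
Proof.
  rewrite !is_derive_C_comp; intros [f1 f2].
  assert (He := is_derive_comp exp _ _ _ _ (is_derive_exp _) f1).
  assert (Hc := is_derive_comp cos _ _ _ _ (is_derive_cos _) f2).
  assert (Hs := is_derive_comp sin _ _ _ _ (is_derive_sin _) f2).
  split; eapply is_derive_value.
  - exact (Derive.is_derive_mult _ _ _ _ _ He Hc).
  - unfold scal, cexp, Re, Im; simpl; unfold mult; simpl; ring.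
  - exact (Derive.is_derive_mult _ _ _ _ _ He Hs).
  - unfold scal, cexp, Re, Im; simpl; unfold mult; simpl; ring.
Qed.

Lemma continuous_Cplus (f g : R -> C) (t : R) :
  continuous_C f t -> continuous_C g t -> continuous_C (fun u => (f u + g u)%C) t.
Proof. apply (@continuous_plus R_UniformSpace R_AbsRing C_R_NormedModule). Qed.

Lemma continuous_Cminus (f g : R -> C) (t : R) :
  continuous_C f t -> continuous_C g t -> continuous_C (fun u => (f u - g u)%C) t.
Proof. apply (@continuous_minus R_UniformSpace R_AbsRing C_R_NormedModule). Qed.

Lemma continuous_RtoC (f : R -> R) (t : R) :
  continuous f t -> continuous_C (fun u => RtoC (f u)) t.
Proof. intros H; apply continuous_C_comp; split; [exact H | apply continuous_const]. Qed.

Lemma continuous_Cmult (f g : R -> C) (t : R) :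
  continuous_C f t -> continuous_C g t -> continuous_C (fun u => (f u * g u)%C) t.
Proof.
  rewrite !continuous_C_comp; intros [f1 f2] [g1 g2]; split.
  - apply (continuous_minus (V := R_NormedModule)); apply (continuous_mult (K := R_AbsRing));
      assumption.
  - apply (continuous_plus (V := R_NormedModule)); apply (continuous_mult (K := R_AbsRing));
      assumption.
Qed.

(** * Improper integrals up to the right end *)

Lemma to_left_gt (b : Rbar) (t : R) :
  Rbar_lt t b -> to_left b (fun s => t < s /\ Rbar_lt s b).
Proof.
  unfold to_left, within; destruct b as [b | |]; simpl; intros Htb; try easy.
  - exists (mkposreal (b - t) (proj1 (Rminus_lt_0 _ _) Htb)); simpl.
    intros s Hs Hsb; split; [| exact Hsb].
    apply (@Rabs_lt_between' s b (b - t)) in Hs; lra.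
  - exists t; intros s Hs _; easy.
Qed.

(** A real point below [b] excludes [b = m_infty], the only case in which no real number lies to the
    left of [b] and the filter is improper. *)
Lemma to_left_proper (b : Rbar) (t : R) : Rbar_lt t b -> ProperFilter (to_left b).
Proof.
  intros Htb; split; [| unfold to_left; apply within_filter; apply Rbar_locally_filter].
  destruct b as [b | |].
  - exact (@filter_ex _ _ (at_left_proper_filter b)).
  - intros P [M HM]; exists (M + 1); apply HM; [lra | easy].
  - easy.
Qed.

(** Complex limits are recorded below as real moduli tending to 0, so that squeezing and comparison
    of limits apply to them. *)
Lemma filterlim_Cmod {T : Type} {F : (T -> Prop) -> Prop} {FF : Filter F} (g : T -> C) (L : C) :
  filterlim g F (@locally C_R_NormedModule L) ->
  filterlim (fun s => Cmod (g s - L)%C) F (locally 0).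
Proof.
  intros H.
  apply (filterlim_ext (fun s => @norm R_AbsRing C_R_NormedModule (minus (g s) L))).
  { intros s; apply norm_C_R. }
  assert (E : @norm R_AbsRing C_R_NormedModule (minus L L) = 0).
  { rewrite norm_C_R; change (Cmod (L - L)%C = 0).
    replace (L - L)%C with (RtoC 0) by ring; apply Cmod_0. }
  rewrite <- E.
  apply filterlim_comp with (2 := filterlim_norm _).
  change (filterlim (fun s => @plus C_R_NormedModule (g s) (opp L)) F
            (locally (@plus C_R_NormedModule L (opp L)))).
  eapply filterlim_comp_2;
    [exact H | apply filterlim_const | exact (@filterlim_plus R_AbsRing C_R_NormedModule L (opp L))].
Qed.

Lemma filterlim_R_lin {T : Type} {F : (T -> Prop) -> Prop} {FF : Filter F}
    (f g : T -> R) (l l' p q r : R) :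
  filterlim f F (locally l) -> filterlim g F (locally l') ->
  filterlim (fun s => p * f s + q * g s + r) F (locally (p * l + q * l' + r)).
Proof.
  intros Hf Hg.
  eapply filterlim_comp_2;
    [| apply filterlim_const | apply (@filterlim_plus R_AbsRing R_NormedModule)].
  eapply filterlim_comp_2; [| | apply (@filterlim_plus R_AbsRing R_NormedModule)].
  - exact (filterlim_comp _ _ _ _ _ _ _ _ Hf (@filterlim_scal_r R_AbsRing R_NormedModule _ _)).
  - exact (filterlim_comp _ _ _ _ _ _ _ _ Hg (@filterlim_scal_r R_AbsRing R_NormedModule _ _)).
Qed.

Lemma filterlim_Cmod_lin {T : Type} {F : (T -> Prop) -> Prop} {FF : Filter F}
    (g h : T -> C) (L L' p q : C) :
  filterlim (fun s => Cmod (g s - L)%C) F (locally 0) ->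
  filterlim (fun s => Cmod (h s - L')%C) F (locally 0) ->
  filterlim (fun s => Cmod (p * g s + q * h s - (p * L + q * L'))%C) F (locally 0).
Proof.
  intros Hg Hh.
  apply (filterlim_le_le (F := F) (fun _ => 0) _
           (fun s => Cmod p * Cmod (g s - L)%C + Cmod q * Cmod (h s - L')%C) 0).
  - apply filter_forall; intros s; split; [apply Cmod_ge_0 |].
    rewrite <- !Cmod_mult.
    replace (p * g s + q * h s - (p * L + q * L'))%C
      with (p * (g s - L) + q * (h s - L'))%C by ring.
    apply Cmod_triangle.
  - apply filterlim_const.
  - apply (filterlim_ext (fun s => Cmod p * Cmod (g s - L)%C + Cmod q * Cmod (h s - L')%C + 0)).
    { intros s; ring. }
    replace (Finite 0) with (Finite (Cmod p * 0 + Cmod q * 0 + 0)) by (f_equal; ring).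
    exact (filterlim_R_lin _ _ _ _ _ _ _ Hg Hh).
Qed.

(** The increment of [g] is the integral of [dg], whose modulus is at most the integral of the bound
    [k]. *)
Lemma Cmod_increment_le (g dg : R -> C) (k : R -> R) (s s' : R) :
  s <= s' ->
  (forall u, s <= u <= s' -> is_derive_C g u (dg u)) ->
  (forall u, s <= u <= s' -> continuous_C dg u) ->
  (forall u, s <= u <= s' -> continuous k u) ->
  (forall u, s <= u <= s' -> Cmod (dg u) <= k u) ->
  Cmod (g s' - g s)%C <= RInt k s s'.
Proof.
  intros Hs Hg Hdg Hk Hle.
  rewrite <- norm_C_R.
  apply (@norm_RInt_le C_R_NormedModule dg k s s'); [exact Hs | | |].
  - intros u Hu; rewrite norm_C_R; auto.
  - apply (@is_RInt_derive C_R_CompleteNormedModule g dg);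
      intros u; rewrite Rmin_left, Rmax_right by exact Hs; auto.
  - apply (RInt_correct (V := R_CompleteNormedModule)), ex_RInt_continuous.
    intros u; rewrite Rmin_left, Rmax_right by exact Hs; auto.
Qed.

(** * Functions whose derivative is dominated by an improperly integrable function *)

Section ImproperIncrement.

Variables (b : Rbar) (t kappa : R) (g dg : R -> C) (k : R -> R).
Hypothesis t_lt_b : Rbar_lt t b.
Hypothesis g_derive : forall u, t <= u -> Rbar_lt u b -> is_derive_C g u (dg u).
Hypothesis dg_cont : forall u, t <= u -> Rbar_lt u b -> continuous_C dg u.
Hypothesis k_cont : forall u, t <= u -> Rbar_lt u b -> continuous k u.
Hypothesis dg_le : forall u, t <= u -> Rbar_lt u b -> Cmod (dg u) <= k u.
Hypothesis k_lim : filterlim (fun s => RInt k t s) (to_left b) (locally kappa).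

Lemma RInt_tail_increment (s s' : R) :
  t <= s <= s' -> Rbar_lt s' b -> Cmod (g s' - g s)%C <= RInt k t s' - RInt k t s.
Proof.
  intros [Hs Hs'] Hb.
  assert (Hlt : forall u, u <= s' -> Rbar_lt u b)
    by (intros u Hu; apply Rbar_le_lt_trans with (2 := Hb); exact Hu).
  assert (E : RInt k t s + RInt k s s' = RInt k t s').
  { apply (RInt_Chasles (V := R_CompleteNormedModule) k t s s');
      apply ex_RInt_continuous; intros u.
    - rewrite Rmin_left, Rmax_right by exact Hs.
      intros Hu; apply k_cont; [lra | apply Hlt; lra].
    - rewrite Rmin_left, Rmax_right by exact Hs'.
      intros Hu; apply k_cont; [lra | apply Hlt; lra]. }
  replace (RInt k t s' - RInt k t s) with (RInt k s s') by lra.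
  apply Cmod_increment_le with (dg := dg); [exact Hs' | ..]; intros u [H1 H2];
    assert (t <= u) by lra; auto.
Qed.

(** The partial integrals of [k] are nondecreasing, because their increments dominate moduli of
    increments of [g]; hence they stay below their limit. *)
Lemma RInt_tail_le (s : R) : t <= s -> Rbar_lt s b -> RInt k t s <= kappa.
Proof.
  assert (FF := to_left_proper b t t_lt_b).
  intros Hs Hb.
  apply (filterlim_le (F := to_left b) (fun _ => RInt k t s) (fun s' => RInt k t s')
           (RInt k t s) kappa).
  - apply filter_imp with (2 := to_left_gt b s Hb); intros s' [H1 H2].
    assert (H := RInt_tail_increment s s' (conj Hs (Rlt_le _ _ H1)) H2).
    generalize (Cmod_ge_0 (g s' - g s)); lra.
  - apply filterlim_const.
  - exact k_lim.
Qed.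

(** Increments of [g] are at most those of the convergent function [RInt k t], so the Cauchy
    criterion passes from the latter to [g]. *)
Lemma improper_increment_limit :
  exists L : C, filterlim (fun s => Cmod (g s - L)%C) (to_left b) (locally 0).
Proof.
  assert (FF := to_left_proper b t t_lt_b).
  destruct (proj1 (filterlim_locally_cauchy (U := C_R_CompleteNormedModule) (F := to_left b) g))
    as [L HL].
  - intros eps.
    (* Two partial integrals within [eps / 2] of [kappa] differ by less than [eps]. *)
    exists (fun s => (t < s /\ Rbar_lt s b) /\ ball kappa (pos_div_2 eps) (RInt k t s)); split.
    + apply filter_and; [apply to_left_gt, t_lt_b |].
      exact (proj1 (filterlim_locally _ _) k_lim (pos_div_2 eps)).
    + assert (W : forall u v, u <= v -> (t < u /\ Rbar_lt u b) /\ ball kappa (pos_div_2 eps) (RInt k t u) ->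
        (t < v /\ Rbar_lt v b) /\ ball kappa (pos_div_2 eps) (RInt k t v) ->
        Cmod (g v - g u)%C < eps).
      { intros u v Huv [[H1 H2] H3] [[H4 H5] H6].
        apply Rle_lt_trans with (1 := RInt_tail_increment u v (conj (Rlt_le _ _ H1) Huv) H5).
        apply (Rabs_lt_between' (RInt k t u) kappa (eps / 2)) in H3.
        apply (Rabs_lt_between' (RInt k t v) kappa (eps / 2)) in H6.
        lra. }
      intros u v Hu Hv.
      apply (@norm_compat1 R_AbsRing C_R_NormedModule).
      rewrite norm_C_R.
      destruct (Rle_dec u v) as [Huv | Huv].
      * exact (W u v Huv Hu Hv).
      * change (Cmod (g v - g u)%C < eps).
        replace (g v - g u)%C with (- (g u - g v))%C by ring.
        rewrite Cmod_opp.
        apply W; [lra | exact Hv | exact Hu].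
  - exists L; apply filterlim_Cmod, HL.
Qed.

(** For s > t, |g(t) - L| <= |g(s) - g(t)| + |g(s) - L| <= kappa + |g(s) - L|, and s tends to b. *)
Lemma improper_increment_le (L : C) :
  filterlim (fun s => Cmod (g s - L)%C) (to_left b) (locally 0) -> Cmod (g t - L)%C <= kappa.
Proof.
  assert (FF := to_left_proper b t t_lt_b).
  intros HL.
  apply Rle_trans with (kappa + 0); [| lra].
  apply (filterlim_le (F := to_left b) (fun _ => Cmod (g t - L)%C)
           (fun s => kappa + Cmod (g s - L)%C) (Cmod (g t - L)%C) (kappa + 0)).
  - apply filter_imp with (2 := to_left_gt b t t_lt_b); intros s [H1 H2].
    assert (H := RInt_tail_increment t s (conj (Rle_refl t) (Rlt_le _ _ H1)) H2).
    rewrite (RInt_point (V := R_CompleteNormedModule)) in H.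
    assert (H' := RInt_tail_le s (Rlt_le _ _ H1) H2).
    replace (g t - L)%C with (- (g s - g t) + (g s - L))%C by ring.
    apply Rle_trans with (1 := Cmod_triangle _ _).
    rewrite Cmod_opp; unfold zero in H; simpl in H; lra.
  - apply filterlim_const.
  - apply (filterlim_ext (fun s => 1 * Cmod (g s - L)%C + 0 * Cmod (g s - L)%C + kappa)).
    { intros s; ring. }
    replace (Finite (kappa + 0)) with (Finite (1 * 0 + 0 * 0 + kappa)) by (f_equal; ring).
    exact (filterlim_R_lin _ _ _ _ _ _ _ HL HL).
Qed.

End ImproperIncrement.

(** * Variation of constants *)

Lemma jordan_apply (lambda : R -> C) (mu : R -> R) (t : R) (v : C2) :
  mat2_apply (jordan_matrix lambda mu t) v =
  ((lambda t * fst v + mu t * snd v)%C, (lambda t * snd v)%C).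
Proof.
  unfold mat2_apply; cbn; f_equal; ring.
Qed.

Lemma norm_inf_le (v w : C2) (x : R) :
  norm_inf (minus v w) <= x <-> Cmod (fst v - fst w)%C <= x /\ Cmod (snd v - snd w)%C <= x.
Proof.
  split.
  - intros H; split; apply Rle_trans with (2 := H); [apply Rmax_l | apply Rmax_r].
  - intros [H1 H2]; apply Rmax_lub; assumption.
Qed.

Lemma sup_on_le (I : R -> Prop) (f : R -> R) (x : R) :
  Rbar_le (sup_on I f) x <-> forall t, I t -> f t <= x.
Proof.
  unfold sup_on; destruct (Lub_Rbar_correct (fun y => exists t, I t /\ y = f t)) as [H1 H2].
  split.
  - intros H t Ht; apply (Rbar_le_trans (f t) _ x) with (2 := H), H1.
    exists t; easy.
  - intros H; apply H2; intros y [t [Ht ->]]; apply H, Ht.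
Qed.

(* The functions differentiated here are the components of [X^{-1} (p1, p2)]. *)
Lemma variation_of_constants (Lam p1 p2 : R -> C) (M : R -> R) (t : R) (l d1 d2 : C) (m : R) :
  is_derive_C Lam t l -> is_derive M t m -> is_derive_C p1 t d1 -> is_derive_C p2 t d2 ->
  let r1 := (d1 - (l * p1 t + m * p2 t))%C in
  let r2 := (d2 - l * p2 t)%C in
  is_derive_C (fun u => cexp (- Lam u) * (p1 u - M u * p2 u))%C t
    (cexp (- Lam t) * (r1 - M t * r2))%C /\
  is_derive_C (fun u => cexp (- Lam u) * p2 u)%C t (cexp (- Lam t) * r2)%C.
Proof.
  intros HL HM H1 H2 r1 r2.
  assert (HE := is_derive_cexp _ _ _ (is_derive_Copp _ _ _ HL)).
  assert (HM' := is_derive_RtoC _ _ _ HM).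
  split; eapply is_derive_C_value.
  - exact (is_derive_Cmult _ _ _ _ _ HE
             (is_derive_Cminus _ _ _ _ _ H1 (is_derive_Cmult _ _ _ _ _ HM' H2))).
  - unfold r1, r2; ring.
  - exact (is_derive_Cmult _ _ _ _ _ HE H2).
  - unfold r2; ring.
Qed.

(** As X' = A X, differentiating X (p1, p2) leaves the residual X (p1', p2'). Constant p1, p2 give
    the solutions; p1, p2 with prescribed derivatives give the extremal perturbed function of the
    lower bound. *)
Lemma fundamental_solution (Lam p1 p2 : R -> C) (M : R -> R) (t : R) (l d1 d2 : C) (m : R) :
  is_derive_C Lam t l -> is_derive M t m -> is_derive_C p1 t d1 -> is_derive_C p2 t d2 ->
  let x1 := (cexp (Lam t) * (p1 t + M t * p2 t))%C in
  let x2 := (cexp (Lam t) * p2 t)%C in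
  is_derive_C (fun u => cexp (Lam u) * (p1 u + M u * p2 u))%C t
    (l * x1 + m * x2 + cexp (Lam t) * (d1 + M t * d2))%C /\
  is_derive_C (fun u => cexp (Lam u) * p2 u)%C t (l * x2 + cexp (Lam t) * d2)%C.
Proof.
  intros HL HM H1 H2 x1 x2.
  assert (HE := is_derive_cexp _ _ _ HL).
  assert (HM' := is_derive_RtoC _ _ _ HM).
  split; eapply is_derive_C_value.
  - exact (is_derive_Cmult _ _ _ _ _ HE
             (is_derive_Cplus _ _ _ _ _ H1 (is_derive_Cmult _ _ _ _ _ HM' H2))).
  - unfold x1, x2; ring.
  - exact (is_derive_Cmult _ _ _ _ _ HE H2).
  - unfold x2; ring.
Qed.

(** * One-sided derivatives on a subset of the line *)

Lemma within_locally_proper (I : R -> Prop) (t : R) : I t -> ProperFilter (within I (locally t)).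
Proof.
  intros Ht; split; [| apply within_filter, locally_filter].
  intros P HP; exists t; exact (locally_singleton t _ HP Ht).
Qed.

(** [filterdiff] tests the remainder at every limit of its filter. For [t] in [I] the restricted
    filter is proper, so [t] is its only limit and a single estimate remains. *)
Lemma is_derive_within_iff (I : R -> Prop) (f : R -> C2) (t : R) (l : C2) : I t ->
  is_derive_within I f t l <->
  forall eps : posreal, locally t (fun u => I u ->
    norm (minus (minus (f u) (f t)) (scal (minus u t) l)) <= eps * norm (minus u t)).
Proof.
  intros Ht; split.
  - intros [_ Hd]; exact (Hd t (filter_le_within (F := locally t) I)).
  - intros H; split; [apply is_linear_scal_l |].
    intros x Hx.
    assert (FF := within_locally_proper I t Ht).
    rewrite (is_filter_lim_unique (V := R_NormedModule) (F := within I (locally t)) x t Hx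
               (filter_le_within (F := locally t) I)).
    exact H.
Qed.

Lemma is_derive_within_of_derive (I : R -> Prop) (f : R -> C2) (t : R) (l : C2) :
  I t -> @is_derive R_AbsRing C2 f t l -> is_derive_within I f t l.
Proof.
  intros Ht H.
  apply (@filterdiff_locally R_AbsRing R_NormedModule C2 _ (within_locally_proper I t Ht) f t);
    [| exact H].
  exact (filter_le_within (F := locally t) I).
Qed.

(** * The bounds for given primitives of the coefficients *)

Section Core.

Variables (I : R -> Prop) (b : Rbar) (t0 : R).
Variables (lambda Lam : R -> C) (mu M kappa : R -> R).

Hypothesis I_lt_b : forall t, I t -> Rbar_lt t b.
Hypothesis I_up : forall t s, I t -> t <= s -> Rbar_lt s b -> I s.
Hypothesis I_t0 : I t0.
Hypothesis lambda_cont : forall t, I t -> continuous_C lambda t.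
Hypothesis mu_cont : forall t, I t -> continuous mu t.
Hypothesis mu_ge_0 : forall t, I t -> 0 <= mu t.
Hypothesis Lam_derive : forall t, I t -> is_derive_C Lam t (lambda t).
Hypothesis M_derive : forall t, I t -> is_derive M t (mu t).
Hypothesis Lam_t0 : Lam t0 = RtoC 0.
Hypothesis M_t0 : M t0 = 0.
Hypothesis extend_derive : forall f df : R -> C2,
  (forall t, I t -> is_derive_within I f t (df t)) ->
  exists g : R -> C2, forall t, I t -> g t = f t /\ @is_derive R_AbsRing C2 g t (df t).
Hypothesis extend_cont : forall f : R -> C2,
  continuous_on I f ->
  exists g : R -> C2, forall t, I t -> g t = f t /\ @continuous R_UniformSpace C2 g t.

(** This is [kappa21_integrand] written with primitives; for [t <= u] the absolute value is dropped
    because [M] is nondecreasing. *)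
Definition kernel (t u : R) : R := (1 + (M u - M t)) * exp (Re (Lam t) - Re (Lam u)).

Hypothesis kappa_lim : forall t, I t ->
  filterlim (fun s => RInt (kernel t) t s) (to_left b) (locally (kappa t)).

Let A := jordan_matrix lambda mu.

Lemma I_between (t u s : R) : I t -> I s -> t <= u <= s -> I u.
Proof.
  intros Ht Hs Hu; apply I_up with t; [exact Ht | apply Hu |].
  apply Rbar_le_lt_trans with (2 := I_lt_b s Hs); apply Hu.
Qed.

Lemma M_incr (t s : R) : I t -> I s -> t <= s -> M t <= M s.
Proof.
  intros Ht Hs Hts.
  assert (HI : forall x, Rmin t s <= x <= Rmax t s -> I x).
  { intros x; rewrite Rmin_left, Rmax_right by exact Hts; apply I_between; assumption. }
  destruct (MVT_gen M t s mu) as [c [Hc E]].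
  - intros x Hx; apply M_derive, HI; split; apply Rlt_le, Hx.
  - intros x Hx; apply continuity_pt_filterlim.
    apply (@ex_derive_continuous R_AbsRing R_NormedModule M); exists (mu x).
    apply M_derive, HI, Hx.
  - assert (0 <= mu c * (s - t)) by (apply Rmult_le_pos; [apply mu_ge_0, HI, Hc | lra]).
    lra.
Qed.

Lemma M_cont (t : R) : I t -> continuous M t.
Proof.
  intros Ht; apply (@ex_derive_continuous R_AbsRing R_NormedModule M); exists (mu t).
  apply M_derive, Ht.
Qed.

Lemma Lam_cont (t : R) : I t -> continuous_C Lam t.
Proof. intros Ht; apply continuous_C_of_derive with (lambda t), Lam_derive, Ht. Qed.

Lemma cexp_opp_Lam_cont (t : R) : I t -> continuous_C (fun u => cexp (- Lam u)%C) t.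
Proof.
  intros Ht; eapply continuous_C_of_derive.
  apply is_derive_cexp, is_derive_Copp, Lam_derive, Ht.
Qed.

Lemma exp_opp_Lam_cont (t : R) : I t -> continuous (fun u => exp (- Re (Lam u))) t.
Proof.
  intros Ht; apply (continuous_comp (fun u => - Re (Lam u)) exp).
  - apply (continuous_opp (V := R_NormedModule)).
    apply (continuous_C_comp Lam t), Lam_cont, Ht.
  - apply continuous_exp.
Qed.

Lemma kernel_cont (t u : R) : I u -> continuous (kernel t) u.
Proof.
  intros Hu.
  apply (continuous_ext (fun u => (1 - M t + M u) * (exp (Re (Lam t)) * exp (- Re (Lam u))))).
  { intros x; unfold kernel, Rminus; rewrite exp_plus; simpl; ring. }
  apply (continuous_mult (K := R_AbsRing)).
  - apply (continuous_plus (V := R_NormedModule)); [apply continuous_const | apply M_cont, Hu].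
  - apply (continuous_mult (K := R_AbsRing)); [apply continuous_const |].
    apply exp_opp_Lam_cont, Hu.
Qed.

(** The left-hand side is the row sum of the second row of X(t) X(u)^{-1}; thus the same kernel
    controls the second component, and it is positive. *)
Lemma kernel_ge (t u : R) : I t -> I u -> t <= u -> exp (Re (Lam t) - Re (Lam u)) <= kernel t u.
Proof.
  intros Ht Hu Htu; unfold kernel.
  assert (0 <= (M u - M t) * exp (Re (Lam t) - Re (Lam u))).
  { apply Rmult_le_pos; [generalize (M_incr t u Ht Hu Htu); lra | apply Rlt_le, exp_pos]. }
  lra.
Qed.

Lemma Cmod_cexp_ratio (t u : R) :
  Cmod (cexp (Lam t) * cexp (- Lam u))%C = exp (Re (Lam t) - Re (Lam u)).
Proof. rewrite Cmod_mult, !Cmod_cexp, <- exp_plus; f_equal. Qed.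

(** The integral of the positive kernel over some [t, s] is positive and bounds [kappa t] from
    below. Positivity is part of the notion of Ulam constant, so the supremum of [kappa] must have
    it. *)
Lemma kappa_gt_0 (t : R) : I t -> 0 < kappa t.
Proof.
  intros Ht.
  assert (FF := to_left_proper b t (I_lt_b t Ht)).
  destruct (filter_ex _ (to_left_gt b t (I_lt_b t Ht))) as [s [Hs Hsb]].
  assert (Hup : forall u, t <= u -> Rbar_lt u b -> I u) by (intros; apply I_up with t; assumption).
  assert (Hpos : forall u, t <= u -> Rbar_lt u b -> 0 < kernel t u).
  { intros u Hu Hub; apply Rlt_le_trans with (2 := kernel_ge t u Ht (Hup u Hu Hub) Hu), exp_pos. }
  assert (Hlt : forall u, u <= s -> Rbar_lt u b).
  { intros u Hu; apply Rbar_le_lt_trans with (2 := Hsb); exact Hu. }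
  apply Rlt_le_trans with (RInt (kernel t) t s).
  - apply RInt_gt_0; [exact Hs | |]; intros u Hu; [apply Hpos | apply kernel_cont, Hup];
      try apply Hlt; lra.
  (* With the zero function as [g], the domination hypothesis reduces to nonnegativity of the
     kernel. *)
  - apply (RInt_tail_le b t (kappa t) (fun _ => RtoC 0) (fun _ => RtoC 0)); auto with real.
    + intros; apply is_derive_Cconst.
    + intros; apply continuous_const.
    + intros u Hu Hub; apply kernel_cont, Hup; assumption.
    + intros u Hu Hub; rewrite Cmod_0; apply Rlt_le, Hpos; assumption.
Qed.

Lemma kernel_scal_lim (t eps : R) : I t ->
  filterlim (fun s => RInt (fun u => eps * kernel t u) t s) (to_left b)
    (locally (eps * kappa t)).
Proof.
  intros Ht.
  apply (filterlim_ext_loc (fun s => eps * RInt (kernel t) t s)).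
  - apply filter_imp with (2 := to_left_gt b t (I_lt_b t Ht)); intros s [H1 H2].
    symmetry; apply (RInt_scal (V := R_CompleteNormedModule)).
    apply ex_RInt_continuous; intros u; rewrite Rmin_left, Rmax_right by lra.
    intros Hu; apply kernel_cont, I_up with t; [exact Ht | lra |].
    apply Rbar_le_lt_trans with (2 := H2); apply Hu.
  - apply filterlim_comp with (1 := kappa_lim t Ht).
    exact (@filterlim_scal_r R_AbsRing R_NormedModule eps (kappa t)).
Qed.

Lemma core_upper_bound (K : R) :
  0 < K -> (forall t, I t -> kappa t <= K) -> is_Ulam_constant I A K.
Proof.
  intros HK HkK; split; [exact HK |].
  intros eps phi dphi Heps Hphi Hdphi Hsup.
  destruct (extend_derive phi dphi Hphi) as [p Hp].
  destruct (extend_cont dphi Hdphi) as [dp Hdp].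
  assert (D1 : forall t, I t -> is_derive_C (fun u => fst (p u)) t (fst (dp t))).
  { intros t Ht; rewrite (proj1 (Hdp t Ht)); apply (is_derive_fst p), (Hp t Ht). }
  assert (D2 : forall t, I t -> is_derive_C (fun u => snd (p u)) t (snd (dp t))).
  { intros t Ht; rewrite (proj1 (Hdp t Ht)); apply (is_derive_snd p), (Hp t Ht). }
  assert (C1 : forall t, I t -> continuous_C (fun u => fst (dp u)) t).
  { intros t Ht; apply (continuous_comp dp fst); [apply (Hdp t Ht) |].
    destruct (dp t); apply continuous_fst. }
  assert (C2 : forall t, I t -> continuous_C (fun u => snd (dp u)) t).
  { intros t Ht; apply (continuous_comp dp snd); [apply (Hdp t Ht) |].
    destruct (dp t); apply continuous_snd. }
  set (r1 := fun t => (fst (dp t) - (lambda t * fst (p t) + mu t * snd (p t)))%C).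
  set (r2 := fun t => (snd (dp t) - lambda t * snd (p t))%C).
  assert (Hr : forall t, I t -> Cmod (r1 t) <= eps /\ Cmod (r2 t) <= eps).
  { intros t Ht.
    generalize (proj1 (sup_on_le I _ eps) Hsup t Ht).
    rewrite norm_inf_le; unfold A; rewrite jordan_apply; simpl fst; simpl snd.
    unfold r1, r2; rewrite (proj1 (Hdp t Ht)), (proj1 (Hp t Ht)); easy. }
  assert (Cp1 : forall t, I t -> continuous_C (fun u => fst (p u)) t)
    by (intros t Ht; apply continuous_C_of_derive with (1 := D1 t Ht)).
  assert (Cp2 : forall t, I t -> continuous_C (fun u => snd (p u)) t)
    by (intros t Ht; apply continuous_C_of_derive with (1 := D2 t Ht)).
  assert (Cr1 : forall t, I t -> continuous_C r1 t).
  { intros t Ht; apply continuous_Cminus; [apply C1, Ht |].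
    apply continuous_Cplus; apply continuous_Cmult; auto.
    apply continuous_RtoC, mu_cont, Ht. }
  assert (Cr2 : forall t, I t -> continuous_C r2 t).
  { intros t Ht; apply continuous_Cminus; [apply C2, Ht |].
    apply continuous_Cmult; auto. }
  set (y1 := fun u => (cexp (- Lam u) * (fst (p u) - M u * snd (p u)))%C).
  set (y2 := fun u => (cexp (- Lam u) * snd (p u))%C).
  assert (Dy : forall t, I t ->
      is_derive_C y1 t (cexp (- Lam t) * (r1 t - M t * r2 t))%C /\
      is_derive_C y2 t (cexp (- Lam t) * r2 t)%C).
  { intros t Ht.
    exact (variation_of_constants _ _ _ _ _ _ _ _ _ (Lam_derive t Ht) (M_derive t Ht)
             (D1 t Ht) (D2 t Ht)). }
  (* First and second components of [X(t) (y1, y2)], whose increments from [t] are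
     controlled by [eps * kappa t]. *)
  set (z1 := fun t u => (cexp (Lam t) * (y1 u + M t * y2 u))%C).
  set (z2 := fun t u => (cexp (Lam t) * y2 u)%C).
  (* [dz1] and [dz2] are the components of X(t) X(u)^{-1} r(u). *)
  set (dz1 := fun t u => (cexp (Lam t) * cexp (- Lam u) * (r1 u - (M u - M t)%R * r2 u))%C).
  set (dz2 := fun t u => (cexp (Lam t) * cexp (- Lam u) * r2 u)%C).
  assert (Dz1 : forall t u, I u -> is_derive_C (z1 t) u (dz1 t u)).
  { intros t u Hu; destruct (Dy u Hu) as [H1 H2]; eapply is_derive_C_value.
    - exact (is_derive_Cmult _ _ _ _ _ (is_derive_Cconst (cexp (Lam t)) u)
               (is_derive_Cplus _ _ _ _ _ H1
                  (is_derive_Cmult _ _ _ _ _ (is_derive_Cconst (M t) u) H2))).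
    - unfold dz1; rewrite RtoC_minus; ring. }
  assert (Dz2 : forall t u, I u -> is_derive_C (z2 t) u (dz2 t u)).
  { intros t u Hu; destruct (Dy u Hu) as [H1 H2]; eapply is_derive_C_value.
    - exact (is_derive_Cmult _ _ _ _ _ (is_derive_Cconst (cexp (Lam t)) u) H2).
    - unfold dz2; ring. }
  assert (Cdz1 : forall t u, I u -> continuous_C (dz1 t) u).
  { intros t u Hu; apply continuous_Cmult.
    - apply continuous_Cmult; [apply continuous_const | apply cexp_opp_Lam_cont, Hu].
    - apply continuous_Cminus; [apply Cr1, Hu |].
      apply continuous_Cmult; [apply continuous_RtoC | apply Cr2, Hu].
      apply (continuous_minus (V := R_NormedModule)); [apply M_cont, Hu | apply continuous_const]. }
  assert (Cdz2 : forall t u, I u -> continuous_C (dz2 t) u).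
  { intros t u Hu; apply continuous_Cmult; [| apply Cr2, Hu].
    apply continuous_Cmult; [apply continuous_const | apply cexp_opp_Lam_cont, Hu]. }
  assert (Bdz1 : forall t u, I t -> I u -> t <= u -> Cmod (dz1 t u) <= eps * kernel t u).
  { intros t u Ht Hu Htu; unfold dz1, kernel.
    rewrite Cmod_mult, Cmod_cexp_ratio, (Rmult_comm _ (exp _)), <- Rmult_assoc,
      (Rmult_comm eps), Rmult_assoc.
    apply Rmult_le_compat_l; [apply Rlt_le, exp_pos |].
    destruct (Hr u Hu) as [H1 H2].
    assert (HM := M_incr t u Ht Hu Htu).
    unfold Cminus; apply Rle_trans with (1 := Cmod_triangle _ _).
    rewrite Cmod_opp, Cmod_mult, Cmod_R, Rabs_pos_eq by lra.
    assert ((M u - M t) * Cmod (r2 u) <= (M u - M t) * eps)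
      by (apply Rmult_le_compat_l; lra).
    lra. }
  assert (Bdz2 : forall t u, I t -> I u -> t <= u -> Cmod (dz2 t u) <= eps * kernel t u).
  { intros t u Ht Hu Htu; unfold dz2.
    rewrite Cmod_mult, Cmod_cexp_ratio, (Rmult_comm eps).
    apply Rmult_le_compat; [apply Rlt_le, exp_pos | apply Cmod_ge_0 | apply kernel_ge; assumption |].
    apply (Hr u Hu). }
  assert (Hup : forall t u, I t -> t <= u -> Rbar_lt u b -> I u) by (intros; eapply I_up; eauto).
  assert (Ck : forall t u, I u -> continuous (fun u => eps * kernel t u) u).
  { intros t u Hu; apply (continuous_scal_r (V := R_NormedModule)), kernel_cont, Hu. }
  (* At [t0] the matrix X is the identity, so these limits are those of X^{-1} phi itself and do not
     depend on a base point. *)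
  destruct (improper_increment_limit b t0 (eps * kappa t0) (z1 t0) (dz1 t0)
              (fun u => eps * kernel t0 u)) as [l1 Hl1]; eauto.
  { apply kernel_scal_lim, I_t0. }
  destruct (improper_increment_limit b t0 (eps * kappa t0) (z2 t0) (dz2 t0)
              (fun u => eps * kernel t0 u)) as [l2 Hl2]; eauto.
  { apply kernel_scal_lim, I_t0. }
  assert (E1 : forall u, z1 t0 u = y1 u).
  { intros u; unfold z1; rewrite Lam_t0, M_t0, cexp_0; ring. }
  assert (E2 : forall u, z2 t0 u = y2 u).
  { intros u; unfold z2; rewrite Lam_t0, cexp_0; ring. }
  set (x := fun t => ((cexp (Lam t) * (l1 + M t * l2))%C, (cexp (Lam t) * l2)%C) : Defs.C2).
  exists x; split.
  - intros t Ht; apply is_derive_within_of_derive; [exact Ht |].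
    unfold A; rewrite jordan_apply.
    destruct (fundamental_solution _ _ _ _ _ _ _ _ _ (Lam_derive t Ht) (M_derive t Ht)
                (is_derive_Cconst l1 t) (is_derive_Cconst l2 t)) as [H1 H2].
    eapply is_derive_value.
    + exact (is_derive_pair _ _ _ _ _ H1 H2).
    + unfold x; simpl fst; simpl snd; f_equal; ring.
  - rewrite sup_on_le; intros t Ht.
    apply Rle_trans with (eps * kappa t).
    2: { rewrite Rmult_comm; apply Rmult_le_compat_r; [lra | apply HkK, Ht]. }
    rewrite norm_inf_le, <- (proj1 (Hp t Ht)).
    assert (FF := to_left_proper b t (I_lt_b t Ht)).
    split.
    (* X(t) X(t)^{-1} = 1, so [z1 t t] is the first component of phi at [t], and the increment bound
       from [t] to [b] is the bound on phi - x. *)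
    + replace (fst (p t) - fst (x t))%C with (z1 t t - cexp (Lam t) * (l1 + M t * l2))%C.
      2: { unfold z1, y1, y2, x; simpl fst.
           destruct (p t) as [p1 p2]; simpl.
           transitivity (cexp (Lam t) * cexp (- Lam t) * p1
                         - cexp (Lam t) * (l1 + M t * l2))%C; [ring |].
           rewrite cexp_opp_r; ring. }
      apply (improper_increment_le b t (eps * kappa t) (z1 t) (dz1 t) (fun u => eps * kernel t u));
        eauto using kernel_scal_lim.
      (* The limit for base point [t] follows from those for [t0]: [z1 t] is the combination of
         [z1 t0] and [z2 t0] with the entries of the first row of X(t). *)
      apply (filterlim_ext (fun s =>
        Cmod (cexp (Lam t) * z1 t0 s + cexp (Lam t) * M t * z2 t0 s
              - (cexp (Lam t) * l1 + cexp (Lam t) * M t * l2))%C)).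
      * intros s; f_equal; rewrite E1, E2; unfold z1; ring.
      * apply filterlim_Cmod_lin; assumption.
    + replace (snd (p t) - snd (x t))%C with (z2 t t - cexp (Lam t) * l2)%C.
      2: { unfold z2, y2, x; simpl snd.
           destruct (p t) as [p1 p2]; simpl.
           transitivity (cexp (Lam t) * cexp (- Lam t) * p2 - cexp (Lam t) * l2)%C; [ring |].
           rewrite cexp_opp_r; ring. }
      apply (improper_increment_le b t (eps * kappa t) (z2 t) (dz2 t) (fun u => eps * kernel t u));
        eauto using kernel_scal_lim.
      apply (filterlim_ext (fun s =>
        Cmod (0 * z1 t0 s + cexp (Lam t) * z2 t0 s - (0 * l1 + cexp (Lam t) * l2))%C)).
      * intros s; f_equal; rewrite E1, E2; unfold z2; ring.
      * apply filterlim_Cmod_lin; assumption.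
Qed.



(** * Sharpness: every Ulam constant bounds kappa *)

Section Lower.

(** (P, Q) is a primitive of X^{-1} r for the extremal perturbation r. It is real, so that order
    arguments are available. *)
Variables (P Q : R -> R) (K : R).
Hypothesis growth : filterlim (fun s => Re (Lam s)) (to_left b) (Rbar_locally p_infty).
Hypothesis P_derive : forall t, I t -> is_derive P t (exp (- Re (Lam t)) * (1 + M t)).
Hypothesis Q_derive : forall t, I t -> is_derive Q t (- exp (- Re (Lam t))).

Lemma decay : filterlim (fun s => K * exp (- Re (Lam s))) (to_left b) (locally 0).
Proof.
  replace 0 with (K * 0) by ring.
  apply filterlim_comp with (2 := @filterlim_scal_r R_AbsRing R_NormedModule K 0).
  apply (filterlim_comp _ _ _ (fun s => - Re (Lam s)) exp _ (Rbar_locally m_infty)).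
  - exact (filterlim_comp _ _ _ _ Ropp _ _ _ growth (filterlim_Rbar_opp p_infty)).
  - exact is_lim_exp_m.
Qed.

Lemma Rabs_scal_exp_le (t x : R) :
  exp (Re (Lam t)) * Rabs x <= K -> Rabs x <= K * exp (- Re (Lam t)).
Proof.
  intros H.
  assert (E : exp (Re (Lam t)) * exp (- Re (Lam t)) = 1)
    by (rewrite <- exp_plus, Rplus_opp_r; apply exp_0).
  replace (Rabs x) with (exp (Re (Lam t)) * Rabs x * exp (- Re (Lam t))).
  - apply Rmult_le_compat_r; [apply Rlt_le, exp_pos | exact H].
  - rewrite (Rmult_comm _ (Rabs x)), Rmult_assoc, E; ring.
Qed.

Lemma to_left_I : to_left b (fun s => t0 < s /\ I s).
Proof.
  apply filter_imp with (2 := to_left_gt b t0 (I_lt_b t0 I_t0)); intros s [H1 H2].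
  split; [exact H1 | apply I_up with t0; auto with real].
Qed.

(** The assumption reads |f - l| <= K e^{-Re Lam}, and the right-hand side tends to 0 at b. This is
    how the growth of Re Lam singles out one admissible solution. *)
Lemma filterlim_of_decay (f : R -> R) (l : R) :
  (forall s, I s -> exp (Re (Lam s)) * Rabs (f s - l) <= K) ->
  filterlim f (to_left b) (locally l).
Proof.
  intros Hf.
  assert (FF := to_left_proper b t0 (I_lt_b t0 I_t0)).
  apply (filterlim_le_le (F := to_left b) (fun s => -1 * (K * exp (- Re (Lam s))) + 0 * (K * exp (- Re (Lam s))) + l) f
           (fun s => 1 * (K * exp (- Re (Lam s))) + 0 * (K * exp (- Re (Lam s))) + l) l).
  - apply filter_imp with (2 := to_left_I); intros s [_ Hs].
    assert (H := Rabs_scal_exp_le s _ (Hf s Hs)).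
    apply Rabs_le_between in H; lra.
  - replace (Finite l) with (Finite (-1 * 0 + 0 * 0 + l)) by (f_equal; ring).
    exact (filterlim_R_lin _ _ _ _ _ _ _ decay decay).
  - replace (Finite l) with (Finite (1 * 0 + 0 * 0 + l)) by (f_equal; ring).
    exact (filterlim_R_lin _ _ _ _ _ _ _ decay decay).
Qed.

(** P'(u) + M(t) Q'(u) = e^{-Re Lam(u)} (1 + M(u) - M(t)), which is the kernel up to the factor
    e^{Re Lam(t)}. *)
Lemma RInt_kernel (t s : R) : I t -> I s -> t <= s ->
  is_RInt (kernel t) t s (exp (Re (Lam t)) * (P s - P t + M t * (Q s - Q t))).
Proof.
  intros Ht Hs Hts.
  set (F := fun u => exp (Re (Lam t)) * (P u + M t * Q u)).
  replace (_ * _) with (minus (F s) (F t)) by (unfold F, minus, plus, opp; simpl; ring).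
  apply (is_RInt_derive (V := R_CompleteNormedModule));
    intros u; rewrite Rmin_left, Rmax_right by exact Hts; intros Hu;
    assert (HI := I_between t u s Ht Hs Hu).
  - apply is_derive_value with (exp (Re (Lam t)) *
      (exp (- Re (Lam u)) * (1 + M u) + M t * - exp (- Re (Lam u)))).
    + apply is_derive_scal.
      apply (is_derive_plus (V := R_NormedModule)); [apply P_derive, HI |].
      apply is_derive_scal, Q_derive, HI.
    + unfold kernel, Rminus; rewrite exp_plus; simpl; ring.
  - apply kernel_cont, HI.
Qed.

Lemma RInt_kernel_ge_0 (t s : R) : I t -> I s -> t <= s ->
  0 <= P s - P t + M t * (Q s - Q t).
Proof.
  intros Ht Hs Hts.
  apply Rmult_le_reg_l with (exp (Re (Lam t))); [apply exp_pos |].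
  rewrite Rmult_0_r.
  apply (is_RInt_ge_0 (kernel t) t s); [exact Hts | apply RInt_kernel; assumption |].
  intros u Hu.
  apply Rle_trans with (2 := kernel_ge t u Ht (I_between t u s Ht Hs ltac:(lra)) ltac:(lra)).
  apply Rlt_le, exp_pos.
Qed.

Lemma Q_decr (t s : R) : I t -> I s -> t <= s -> Q s <= Q t.
Proof.
  intros Ht Hs Hts.
  assert (HI : forall x, Rmin t s <= x <= Rmax t s -> I x).
  { intros x; rewrite Rmin_left, Rmax_right by exact Hts; apply I_between; assumption. }
  destruct (MVT_gen Q t s (fun u => - exp (- Re (Lam u)))) as [c [Hc E]].
  - intros x Hx; apply Q_derive, HI; split; apply Rlt_le, Hx.
  - intros x Hx; apply continuity_pt_filterlim.
    apply (@ex_derive_continuous R_AbsRing R_NormedModule Q); eexists.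
    apply Q_derive, HI, Hx.
  - assert (0 <= exp (- Re (Lam c)) * (s - t))
      by (apply Rmult_le_pos; [apply Rlt_le, exp_pos | lra]).
    lra.
Qed.

(* The decay of [e^{-Re Lam}] forces [q = lim Q]; then
   [P <= P + M (Q - q) <= lim P] forces [p = lim P]. *)
Lemma kappa_le_of_bounded (p q : R) :
  (forall t, I t -> exp (Re (Lam t)) * Rabs (Q t - q) <= K) ->
  (forall t, I t -> exp (Re (Lam t)) * Rabs (P t + M t * (Q t - q) - p) <= K) ->
  forall t, I t -> kappa t <= K.
Proof.
  intros Hq Hp.
  assert (FF := to_left_proper b t0 (I_lt_b t0 I_t0)).
  assert (Qq := filterlim_of_decay Q q Hq).
  assert (Vp := filterlim_of_decay (fun t => P t + M t * (Q t - q)) p Hp).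
  (* Since [Lam] and [M] vanish at [t0], [P] is a primitive of [kernel t0], and its convergence is
     that of the integral defining [kappa t0]. *)
  assert (PP : filterlim P (to_left b) (locally (P t0 + kappa t0))).
  { apply (filterlim_ext_loc (fun s => P t0 + RInt (kernel t0) t0 s)).
    - apply filter_imp with (2 := to_left_I); intros s [H1 H2].
      rewrite (is_RInt_unique _ _ _ _ (RInt_kernel t0 s I_t0 H2 (Rlt_le _ _ H1))).
      rewrite Lam_t0, M_t0; unfold Re, RtoC; simpl fst; rewrite exp_0; ring.
    - eapply filterlim_comp_2; [apply filterlim_const | exact (kappa_lim t0 I_t0) |].
      exact (@filterlim_plus R_AbsRing R_NormedModule (P t0) (kappa t0)). }
  set (P_b := P t0 + kappa t0) in PP.
  assert (L : forall t, filterlim (fun s => P s - P t + M t * (Q s - Q t)) (to_left b)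
                (locally (P_b - P t + M t * (q - Q t)))).
  { intros t.
    apply (filterlim_ext (fun s => 1 * P s + M t * Q s + (- P t - M t * Q t))).
    { intros s; ring. }
    replace (P_b - P t + M t * (q - Q t)) with (1 * P_b + M t * q + (- P t - M t * Q t)) by ring.
    exact (filterlim_R_lin _ _ _ _ _ _ _ PP Qq). }
  assert (Ep : p = P_b).
  { apply (filterlim_locally_unique (F := to_left b) (V := R_NormedModule)
             (fun t => P t + M t * (Q t - q))); [exact Vp |].
    apply (filterlim_le_le (F := to_left b) P _ (fun _ => P_b) P_b); [| exact PP | apply filterlim_const].
    apply filter_imp with (2 := to_left_I); intros t [Ht0 Ht].
    assert (HM := M_incr t0 t I_t0 Ht (Rlt_le _ _ Ht0)).
    rewrite M_t0 in HM.
    assert (Hev : to_left b (fun s => t <= s /\ I s)).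
    { apply filter_imp with (2 := to_left_gt b t (I_lt_b t Ht)); intros s [H1 H2].
      split; [lra | apply I_up with t; auto with real]. }
    assert (H1 : Rbar_le q (Q t)).
    { apply (filterlim_le (F := to_left b) Q (fun _ => Q t));
        [| exact Qq | apply filterlim_const].
      apply filter_imp with (2 := Hev); intros s [Hs1 Hs2]; apply Q_decr; assumption. }
    assert (H2 : Rbar_le 0 (P_b - P t + M t * (q - Q t))).
    { apply (filterlim_le (F := to_left b) (fun _ => 0) (fun s => P s - P t + M t * (Q s - Q t)));
        [| apply filterlim_const | apply L].
      apply filter_imp with (2 := Hev); intros s [Hs1 Hs2]; apply RInt_kernel_ge_0; assumption. }
    simpl in H1, H2.
    assert (0 <= M t * (Q t - q)) by (apply Rmult_le_pos; lra).
    lra. }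
  intros t Ht.
  apply Rle_trans with (2 := Hp t Ht).
  (* Letting s tend to b in [RInt_kernel] gives this value of [kappa t]. As [p = P_b], the factor
     after the exponential is the opposite of the quantity inside the absolute value in [Hp]. *)
  replace (kappa t) with (exp (Re (Lam t)) * (P_b - P t + M t * (q - Q t))).
  - apply Rmult_le_compat_l; [apply Rlt_le, exp_pos |].
    rewrite Ep, <- Rabs_Ropp.
    apply Rle_trans with (2 := Rle_abs _); lra.
  - apply (filterlim_locally_unique (F := to_left b) (V := R_NormedModule)
             (fun s => RInt (kernel t) t s)); [| exact (kappa_lim t Ht)].
    apply (filterlim_ext_loc (fun s => exp (Re (Lam t)) * (P s - P t + M t * (Q s - Q t)))).
    + apply filter_imp with (2 := to_left_gt b t (I_lt_b t Ht)); intros s [H1 H2].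
      symmetry; apply is_RInt_unique, RInt_kernel; [exact Ht | | lra].
      apply I_up with t; auto with real.
    + apply filterlim_comp with (1 := L t).
      apply (@filterlim_scal_r R_AbsRing R_NormedModule).
Qed.

(** For a solution the residual vanishes, so X^{-1} x has derivative zero and equals its value at
    [t0] throughout [I]. *)
Lemma solution_form (x : R -> C2) : is_solution I A x ->
  exists c1 c2 : C, forall t, I t ->
    fst (x t) = (cexp (Lam t) * (c1 + M t * c2))%C /\ snd (x t) = (cexp (Lam t) * c2)%C.
Proof.
  intros Hx.
  destruct (extend_derive x (fun t => mat2_apply (A t) (x t)) Hx) as [g Hg].
  set (y1 := fun u => (cexp (- Lam u) * (fst (g u) - M u * snd (g u)))%C).
  set (y2 := fun u => (cexp (- Lam u) * snd (g u))%C).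
  assert (Dy : forall t, I t -> is_derive_C y1 t (RtoC 0) /\ is_derive_C y2 t (RtoC 0)).
  { intros t Ht; destruct (Hg t Ht) as [E H].
    unfold A in H; rewrite jordan_apply, <- E in H.
    assert (H1 := is_derive_fst g t _ H); assert (H2 := is_derive_snd g t _ H).
    simpl fst in H1; simpl snd in H2.
    destruct (variation_of_constants _ _ _ _ _ _ _ _ _ (Lam_derive t Ht) (M_derive t Ht) H1 H2)
      as [G1 G2].
    split; [refine (is_derive_C_value _ _ _ _ G1 _) | refine (is_derive_C_value _ _ _ _ G2 _)];
      ring. }
  assert (cst : forall y : R -> C, (forall t, I t -> is_derive_C y t (RtoC 0)) ->
            forall t, I t -> y t = y t0).
  { intros y Hy t Ht; destruct (Rtotal_order t t0) as [Hl | [-> | Hl]]; [| reflexivity |].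
    - apply (@eq_is_derive C_R_NormedModule y); [| exact Hl].
      intros u Hu; apply Hy, (I_between t u t0); assumption.
    - symmetry; apply (@eq_is_derive C_R_NormedModule y); [| exact Hl].
      intros u Hu; apply Hy, (I_between t0 u t); assumption. }
  exists (y1 t0), (y2 t0); intros t Ht.
  rewrite <- (cst y1 (fun t Ht => proj1 (Dy t Ht)) t Ht), <- (cst y2 (fun t Ht => proj2 (Dy t Ht)) t Ht).
  rewrite <- (proj1 (Hg t Ht)).
  (* This is X X^{-1} = 1, which recovers x from X^{-1} x. *)
  assert (E : forall z g1 g2 m : C,
    g1 = (cexp z * (cexp (- z) * (g1 - m * g2) + m * (cexp (- z) * g2)))%C /\
    g2 = (cexp z * (cexp (- z) * g2))%C).
  { intros z g1 g2 m; split.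
    - transitivity (cexp z * cexp (- z) * g1)%C; [rewrite cexp_opp_r |]; ring.
    - transitivity (cexp z * cexp (- z) * g2)%C; [rewrite cexp_opp_r |]; ring. }
  exact (E (Lam t) (fst (g t)) (snd (g t)) (RtoC (M t))).
Qed.

(* The perturbation [e^{i Im Lam} (1, -1)] maximises the variation of constants integral. *)
Lemma core_lower_bound : is_Ulam_constant I A K -> forall t, I t -> kappa t <= K.
Proof.
  intros [_ HU].
  (* This is e^{i Im Lam}, written so that it appears literally in the residual X (P', Q') = (w,
     -w). *)
  set (w := fun t => (cexp (Lam t) * RtoC (exp (- Re (Lam t))))%C).
  assert (Hw : forall t, Cmod (w t) = 1).
  { intros t; unfold w; rewrite Cmod_mult, Cmod_cexp, Cmod_R, Rabs_pos_eq
      by apply Rlt_le, exp_pos.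
    rewrite <- exp_plus, Rplus_opp_r; apply exp_0. }
  set (phi := fun t => ((cexp (Lam t) * (P t + M t * Q t))%C, (cexp (Lam t) * Q t)%C) : C2).
  set (dphi := fun t => ((lambda t * fst (phi t) + mu t * snd (phi t) + w t)%C,
                         (lambda t * snd (phi t) - w t)%C) : C2).
  assert (Dphi : forall t, I t -> is_derive_C (fun u => fst (phi u)) t (fst (dphi t)) /\
                                is_derive_C (fun u => snd (phi u)) t (snd (dphi t))).
  { intros t Ht.
    destruct (fundamental_solution _ _ _ _ _ _ _ _ _ (Lam_derive t Ht) (M_derive t Ht)
                (is_derive_RtoC _ _ _ (P_derive t Ht)) (is_derive_RtoC _ _ _ (Q_derive t Ht)))
      as [H1 H2].
    split; [refine (is_derive_C_value _ _ _ _ H1 _) | refine (is_derive_C_value _ _ _ _ H2 _)];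
      unfold dphi, phi, w; simpl fst; simpl snd;
      rewrite ?RtoC_opp, ?RtoC_mult, ?RtoC_plus; ring. }
  assert (Cdphi : forall t, I t -> @continuous R_UniformSpace C2 dphi t).
  { intros t Ht.
    assert (C1 := continuous_C_of_derive _ _ _ (proj1 (Dphi t Ht))).
    assert (C2 := continuous_C_of_derive _ _ _ (proj2 (Dphi t Ht))).
    assert (Cw : continuous_C w t).
    { apply continuous_Cmult; [| apply continuous_RtoC, exp_opp_Lam_cont, Ht].
      apply continuous_C_of_derive with (1 := is_derive_cexp _ _ _ (Lam_derive t Ht)). }
    assert (Cl := lambda_cont t Ht).
    apply (@continuous_pair C_UniformSpace C_UniformSpace).
    - apply continuous_Cplus; [| exact Cw].
      apply continuous_Cplus; apply continuous_Cmult; try assumption.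
      apply continuous_RtoC, mu_cont, Ht.
    - apply continuous_Cminus; [| exact Cw].
      apply continuous_Cmult; assumption. }
  destruct (HU 1 phi dphi) as [x [Hx Hsup]].
  - lra.
  - intros t Ht; apply is_derive_within_of_derive; [exact Ht |].
    exact (is_derive_pair _ _ _ _ _ (proj1 (Dphi t Ht)) (proj2 (Dphi t Ht))).
  - intros t Ht.
    apply (filterlim_filter_le_1 (F := locally t)); [| exact (Cdphi t Ht)].
    apply filter_le_within.
  - rewrite sup_on_le; intros t Ht.
    rewrite norm_inf_le; unfold A; rewrite jordan_apply; unfold dphi; simpl fst; simpl snd.
    rewrite <- (Hw t) at 1 2.
    split; right.
    + f_equal; ring.
    + rewrite <- Cmod_opp; f_equal; ring.
  - rewrite Rmult_1_r, sup_on_le in Hsup.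
    destruct (solution_form x Hx) as [c1 [c2 Hc]].
    (* [P], [Q] and [M] are real, so taking real parts of the constants can only decrease the
       distances. *)
    apply (kappa_le_of_bounded (Re c1) (Re c2)); intros t Ht;
      specialize (Hsup t Ht); rewrite norm_inf_le in Hsup; destruct Hsup as [H1 H2];
      destruct (Hc t Ht) as [E1 E2].
    + apply Rle_trans with (2 := H2); rewrite E2; unfold phi; simpl snd.
      replace (_ - _)%C with (cexp (Lam t) * (Q t - c2))%C by ring.
      rewrite Cmod_mult, Cmod_cexp.
      apply Rmult_le_compat_l; [apply Rlt_le, exp_pos |].
      apply Rle_trans with (2 := re_le_Cmod _); right; f_equal.
    + apply Rle_trans with (2 := H1); rewrite E1; unfold phi; simpl fst.
      replace (_ - _)%C with (cexp (Lam t) * (P t + M t * (Q t - c2) - c1))%C by ring.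
      rewrite Cmod_mult, Cmod_cexp.
      apply Rmult_le_compat_l; [apply Rlt_le, exp_pos |].
      apply Rle_trans with (2 := re_le_Cmod _); right; f_equal.
      unfold Re; simpl; ring.
Qed.

End Lower.

End Core.

(** * Extension beyond the endpoints *)

Lemma minus_plus_cancel {G : AbelianGroup} (x v : G) : minus (minus (plus x v) x) v = zero.
Proof.
  unfold minus; rewrite (plus_comm x v), <- (plus_assoc v x), plus_opp_r, plus_zero_r.
  apply plus_opp_r.
Qed.

Lemma plus_scal_diag {V : NormedModule R_AbsRing} (s : R) (x v : V) :
  plus x (scal (s - s) v) = x.
Proof.
  replace (scal (s - s) v) with (@zero V); [apply plus_zero_r |].
  symmetry; rewrite Rminus_diag; exact (scal_zero_l v).
Qed.

Section Retraction.

Variables (lc rc : bool) (a b : Rbar).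
Hypothesis a_lt_b : Rbar_lt a b.

Let I := interval lc rc a b.

Definition clamp_left (t : R) : R :=
  match lc, a with true, Finite x => Rmax x t | _, _ => t end.

Definition clamp_right (t : R) : R :=
  match rc, b with true, Finite y => Rmin y t | _, _ => t end.

(* Retraction onto [interval lc rc a b] of a neighbourhood of it: only the endpoints
   belonging to the interval are clamped. *)
Definition clamp (t : R) : R := clamp_right (clamp_left t).

Lemma interval_between (t u s : R) : I t -> I s -> t <= u <= s -> I u.
Proof.
  unfold I, interval; intros [Ht _] [_ Hs] [H1 H2]; split.
  - destruct lc; [apply Rbar_le_trans with (1 := Ht) | apply Rbar_lt_le_trans with (1 := Ht)];
      exact H1.
  - destruct rc; [apply Rbar_le_trans with (2 := Hs) | apply Rbar_le_lt_trans with (2 := Hs)];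
      exact H2.
Qed.

Lemma interval_up (t s : R) : I t -> t <= s -> Rbar_lt s b -> I s.
Proof.
  intros [H1 H2] Hts Hs; split.
  - destruct lc; [apply Rbar_le_trans with (1 := H1) | apply Rbar_lt_le_trans with (1 := H1)];
      exact Hts.
  - destruct rc; [apply Rbar_lt_le |]; exact Hs.
Qed.

Lemma interval_interior (t : R) : Rbar_lt a t -> Rbar_lt t b -> I t.
Proof.
  intros H1 H2; split; [destruct lc; [apply Rbar_lt_le |]; exact H1
                       | destruct rc; [apply Rbar_lt_le |]; exact H2].
Qed.

Lemma interval_between_minmax (t u s : R) :
  I t -> I s -> Rmin t s <= u <= Rmax t s -> I u.
Proof.
  intros Ht Hs; destruct (Rle_dec t s) as [H | H].
  - rewrite Rmin_left, Rmax_right by exact H; apply interval_between; assumption.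
  - rewrite Rmin_right, Rmax_left by lra; apply interval_between; assumption.
Qed.

Lemma clamp_id (t : R) : I t -> clamp t = t.
Proof.
  unfold I, interval, clamp, clamp_left, clamp_right; intros [H1 H2].
  assert (E : match lc, a with true, Finite x => Rmax x t | _, _ => t end = t).
  { destruct lc; [destruct a as [x | |]; simpl in H1 |]; try reflexivity.
    apply Rmax_right, H1. }
  rewrite E.
  destruct rc; [destruct b as [y | |]; simpl in H2 |]; try reflexivity.
  apply Rmin_right, H2.
Qed.

Lemma clamp_incr (t s : R) : t <= s -> clamp t <= clamp s.
Proof.
  intros H; unfold clamp, clamp_left, clamp_right.
  destruct lc, a, rc, b; try exact H; unfold Rmin, Rmax;
    repeat destruct Rle_dec; lra.
Qed.

(** An interior point has a neighbourhood inside the interval; near an included endpoint, points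
    outside are sent to that endpoint. Local properties of an extension thus have only two cases:
    points of [I], and points clamped to [t]. *)
Lemma clamp_locally (t : R) : I t -> locally t (fun u => I u \/ clamp u = t).
Proof.
  intros Ht; assert (Hc := clamp_id t Ht).
  assert (Hlo : Rbar_lt a t \/ lc = true /\ a = Finite t).
  { destruct Ht as [H _]; destruct lc; [| left; exact H].
    destruct (Rbar_le_lt_or_eq_dec _ _ H); auto. }
  assert (Hhi : Rbar_lt t b \/ rc = true /\ b = Finite t).
  { destruct Ht as [_ H]; destruct rc; [| left; exact H].
    destruct (Rbar_le_lt_or_eq_dec _ _ H); auto. }
  destruct Hlo as [Hlo | [Elc Ea]]; destruct Hhi as [Hhi | [Erc Eb]].
  - apply filter_imp with (2 := filter_and _ _ (open_Rbar_gt' t a Hlo) (open_Rbar_lt' t b Hhi)).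
    intros u [H1 H2]; left; apply interval_interior; assumption.
  - apply filter_imp with (2 := open_Rbar_gt' t a Hlo); intros u Hu.
    destruct (Rle_dec u t) as [H | H].
    + left; split; [destruct lc; [apply Rbar_lt_le |]; exact Hu | rewrite Erc, Eb; exact H].
    + right; apply Rle_antisym.
      * unfold clamp, clamp_right; rewrite Erc, Eb; apply Rmin_l.
      * rewrite <- Hc at 1; apply clamp_incr; lra.
  - apply filter_imp with (2 := open_Rbar_lt' t b Hhi); intros u Hu.
    destruct (Rle_dec t u) as [H | H].
    + left; split; [rewrite Elc, Ea; exact H | destruct rc; [apply Rbar_lt_le |]; exact Hu].
    + right; transitivity (clamp t); [| exact Hc].
      unfold clamp, clamp_left; rewrite Elc, Ea, !Rmax_left by lra; reflexivity.
  - rewrite Ea, Eb in a_lt_b; simpl in a_lt_b; lra.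
Qed.

Lemma continuous_clamp {U : UniformSpace} (f : R -> U) (t : R) :
  continuous_on I f -> I t -> continuous (fun u => f (clamp u)) t.
Proof.
  intros Hf Ht P HP; rewrite (clamp_id t Ht) in HP.
  assert (H : locally t (fun u => I u -> P (f u))) by exact (Hf t Ht P HP).
  change (locally t (fun u => P (f (clamp u)))).
  apply filter_imp with (2 := filter_and _ _ H (clamp_locally t Ht)).
  intros u [H1 [H2 | H2]].
  - rewrite (clamp_id u H2); apply H1, H2.
  - rewrite H2; exact (locally_singleton _ _ HP).
Qed.

(** The correction vanishes on [I] and beyond an included endpoint continues [f] with slope [df]
    there. The remainder at [t] is therefore either the one-sided remainder of [f] or exactly
    zero. *)
Lemma is_derive_clamp (f df : R -> C2) (t : R) :
  (forall u, I u -> is_derive_within I f u (df u)) -> I t ->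
  @is_derive R_AbsRing C2
    (fun u => plus (f (clamp u)) (scal (u - clamp u) (df (clamp u)))) t (df t).
Proof.
  intros Hf Ht.
  split; [apply is_linear_scal_l |].
  intros x Hx; rewrite <- (is_filter_lim_locally_unique (V := R_NormedModule) t x Hx).
  intros eps.
  assert (H := proj1 (is_derive_within_iff I f t (df t) Ht) (Hf t Ht) eps).
  apply filter_imp with (2 := filter_and _ _ H (clamp_locally t Ht)).
  intros u [H1 H2]; rewrite (clamp_id t Ht).
  assert (E : forall s : R, plus (f s) (scal (s - s) (df s)) = f s)
    by (intros s; exact (plus_scal_diag s (f s) (df s))).
  rewrite (E t).
  destruct H2 as [H2 | H2].
  - rewrite (clamp_id u H2), E; apply H1, H2.
  - rewrite H2.
    match goal with |- norm ?z <= _ => replace z with (@zero C2) end.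
    + rewrite norm_zero; apply Rmult_le_pos; [apply Rlt_le, cond_pos | apply norm_ge_0].
    + symmetry; exact (minus_plus_cancel (f t) (scal (u - t) (df t))).
Qed.

Lemma extend_within_derive (f df : R -> C2) :
  (forall t, I t -> is_derive_within I f t (df t)) ->
  exists g : R -> C2, forall t, I t -> g t = f t /\ @is_derive R_AbsRing C2 g t (df t).
Proof.
  intros Hf; eexists; intros t Ht; split; [| exact (is_derive_clamp f df t Hf Ht)].
  simpl; rewrite (clamp_id t Ht); exact (plus_scal_diag t (f t) (df t)).
Qed.

Lemma extend_continuous_on {U : UniformSpace} (f : R -> U) :
  continuous_on I f ->
  exists g : R -> U, forall t, I t -> g t = f t /\ continuous g t.
Proof.
  intros Hf; exists (fun u => f (clamp u)); intros t Ht.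
  split; [rewrite (clamp_id t Ht); reflexivity | apply continuous_clamp; assumption].
Qed.

(** The primitive is the integral of the extension of [f] by [clamp], which is continuous in the
    two-sided sense at points of [I]. Between points of [I] it has the same integrals as [f]. *)
Lemma primitive_on (t0 : R) (f : R -> R) :
  I t0 -> continuous_on I f ->
  exists F : R -> R, F t0 = 0 /\ (forall t, I t -> is_derive F t (f t)) /\
    (forall t s, I t -> I s -> RInt f t s = F s - F t).
Proof.
  intros Ht0 Hf.
  set (g := fun u => f (clamp u)).
  assert (Hg : forall t, I t -> continuous g t) by (intros t Ht; apply continuous_clamp; assumption).
  assert (Eg : forall t, I t -> g t = f t) by (intros t Ht; unfold g; rewrite (clamp_id t Ht); reflexivity).
  assert (Hex : forall t s, I t -> I s -> ex_RInt g t s).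
  { intros t s Ht Hs; apply (ex_RInt_continuous (V := R_CompleteNormedModule)).
    intros u Hu; apply Hg, (interval_between_minmax t u s); assumption. }
  assert (D : forall t, I t -> is_derive (RInt g t0) t (f t)).
  { intros t Ht; rewrite <- (Eg t Ht); apply (is_derive_RInt g _ t0); [| apply Hg, Ht].
    apply filter_imp with (2 := clamp_locally t Ht); intros u Hu.
    apply (RInt_correct (V := R_CompleteNormedModule)).
    destruct Hu as [Hu | Hu]; [apply Hex; assumption |].
    (* Two-sided differentiability at [t] needs integrals up to points [u] outside [I] as well;
       between [t] and such a [u] the extension is constant. *)
    apply ex_RInt_Chasles with t; [apply Hex; assumption |].
    apply (ex_RInt_ext (fun _ => f t)); [| apply ex_RInt_const].
    intros z [H1 H2]; unfold g; f_equal; symmetry.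
    assert (Ez : clamp t = clamp u) by (rewrite Hu; apply clamp_id, Ht).
    rewrite <- Hu; destruct (Rle_dec t u) as [H | H].
    - rewrite Rmin_left in H1 by exact H; rewrite Rmax_right in H2 by exact H.
      apply Rle_antisym; [apply clamp_incr | rewrite <- Ez; apply clamp_incr]; lra.
    - rewrite Rmin_right in H1 by lra; rewrite Rmax_left in H2 by lra.
      apply Rle_antisym; [rewrite <- Ez; apply clamp_incr | apply clamp_incr]; lra. }
  exists (RInt g t0); split; [apply (RInt_point (V := R_CompleteNormedModule)) | split; [exact D |]].
  intros t s Ht Hs; apply is_RInt_unique.
  apply (is_RInt_ext g).
  { intros u Hu; apply Eg, (interval_between_minmax t u s); try assumption; lra. }
  apply (is_RInt_derive (V := R_CompleteNormedModule)); intros u Hu;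
    assert (HI := interval_between_minmax t u s Ht Hs Hu).
  - rewrite (Eg u HI); apply D, HI.
  - apply Hg, HI.
Qed.

End Retraction.

(** * The system near the right end *)

Lemma is_Ulam_constant_ext (I : R -> Prop) (A B : R -> @matrix C 2 2) (K : R) :
  (forall t, I t -> A t = B t) -> is_Ulam_constant I A K -> is_Ulam_constant I B K.
Proof.
  intros E [HK H]; split; [exact HK |].
  intros eps phi dphi Heps Hphi Hdphi Hsup.
  destruct (H eps phi dphi Heps Hphi Hdphi) as [x [Hx Hle]].
  - rewrite sup_on_le in Hsup |- *; intros t Ht; rewrite (E t Ht); apply Hsup, Ht.
  - exists x; split; [| exact Hle].
    intros t Ht; rewrite <- (E t Ht); apply Hx, Ht.
Qed.

Lemma continuous_on_of_continuous {U V : UniformSpace} (D : U -> Prop) (f : U -> V) :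
  (forall x, D x -> continuous f x) -> continuous_on D f.
Proof.
  intros H x Hx P HP; apply (filter_le_within (F := locally x) D), (H x Hx P HP).
Qed.

Lemma continuous_on_Re (D : R -> Prop) (f : R -> C) :
  continuous_on D f -> continuous_on D (fun t => Re (f t)).
Proof.
  intros H t Ht; apply filterlim_comp with (1 := H t Ht).
  destruct (f t); apply continuous_fst.
Qed.

Lemma continuous_on_Im (D : R -> Prop) (f : R -> C) :
  continuous_on D f -> continuous_on D (fun t => Im (f t)).
Proof.
  intros H t Ht; apply filterlim_comp with (1 := H t Ht).
  destruct (f t); apply continuous_snd.
Qed.

Section RightEnd.

Variables (lc rc : bool) (a b : Rbar) (lambda : R -> C) (mu kappa : R -> R) (t0 : R).
Hypothesis a_lt_b : Rbar_lt a b.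

Let I := interval lc rc a b.
Let A := jordan_matrix lambda mu.

Hypothesis lambda_cont : continuous_on I lambda.
Hypothesis mu_cont : continuous_on I mu.
Hypothesis mu_ge_0 : forall t, I t -> 0 <= mu t.
Hypothesis a_lt_t0 : Rbar_lt a t0.
Hypothesis t0_lt_b : Rbar_lt t0 b.
Hypothesis kappa_lim : forall t, I t ->
  filterlim (fun s => RInt (kappa21_integrand lambda mu t) t s) (to_left b) (locally (kappa t)).
Hypothesis growth : filterlim (fun t => RInt (fun s => Re (lambda s)) t0 t)
  (to_left b) (Rbar_locally p_infty).

Let interval_up := interval_up lc rc a b.
Let interval_t0 : I t0 := interval_interior lc rc a b t0 a_lt_t0 t0_lt_b.

(* If [b] belonged to the interval, the integral of [Re lambda] would converge at [b]. *)
Lemma interval_lt_right (t : R) : I t -> Rbar_lt t b.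
Proof.
  intros Ht; apply Rbar_not_le_lt; intros Hbt.
  assert (Eb : b = Finite t).
  { apply Rbar_le_antisym; [exact Hbt |].
    destruct Ht as [_ Ht]; destruct rc; [| apply Rbar_lt_le]; exact Ht. }
  destruct (primitive_on lc rc a b a_lt_b t0 (fun s => Re (lambda s)) interval_t0
              (continuous_on_Re I _ lambda_cont)) as [F [F0 [DF HF]]].
  assert (CF : continuous F t).
  { apply (@ex_derive_continuous R_AbsRing R_NormedModule F); exists (Re (lambda t)).
    apply DF, Ht. }
  assert (FF := to_left_proper b t0 t0_lt_b).
  assert (H1 : to_left b (fun s => Rabs (F s - F t) < 1)).
  { rewrite Eb; apply (filter_le_within (F := locally t) (fun s : R => Rbar_lt s t)).
    exact (proj1 (filterlim_locally F (F t)) CF (mkposreal 1 Rlt_0_1)). }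
  assert (H2 : to_left b (fun s => F t + 1 < RInt (fun s => Re (lambda s)) t0 s)).
  { apply (growth (fun y => F t + 1 < y)); exists (F t + 1); easy. }
  destruct (filter_ex _ (filter_and _ _ (to_left_gt b t0 t0_lt_b) (filter_and _ _ H1 H2)))
    as [s [[Hs Hsb] [Hs1 Hs2]]].
  rewrite (HF t0 s interval_t0), F0 in Hs2
    by (apply interval_up with t0; [exact interval_t0 | lra | exact Hsb]).
  apply Rabs_lt_between in Hs1; lra.
Qed.

(** [kappa] is any function given by the limits of the integrals, which lets the reflected problem
    use it at [- t]. The three clauses are what identifies the least Ulam constant with the supremum
    of [kappa]. *)
Lemma right_end_bounds (K : R) :
  (0 < K -> (forall t, I t -> kappa t <= K) -> is_Ulam_constant I A K) /\
  (is_Ulam_constant I A K -> forall t, I t -> kappa t <= K) /\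
  (forall t, I t -> 0 < kappa t).
Proof.
  (* The coefficients are replaced by extensions that agree with them on [I]; being an Ulam constant
     depends only on the values on [I]. *)
  destruct (extend_continuous_on lc rc a b a_lt_b lambda lambda_cont) as [l Hl].
  destruct (extend_continuous_on lc rc a b a_lt_b mu mu_cont) as [m Hm].
  destruct (primitive_on lc rc a b a_lt_b t0 (fun s => Re (lambda s)) interval_t0
              (continuous_on_Re I _ lambda_cont)) as [LR [LR0 [DLR HLR]]].
  destruct (primitive_on lc rc a b a_lt_b t0 (fun s => Im (lambda s)) interval_t0
              (continuous_on_Im I _ lambda_cont)) as [LI [LI0 [DLI _]]].
  destruct (primitive_on lc rc a b a_lt_b t0 mu interval_t0 mu_cont) as [M [M0 [DM HM]]].
  set (Lam := fun t => (LR t, LI t) : C).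
  assert (lc' : forall t, I t -> continuous_C l t) by (intros t Ht; apply (Hl t Ht)).
  assert (mc' : forall t, I t -> continuous m t) by (intros t Ht; apply (Hm t Ht)).
  assert (m_ge : forall t, I t -> 0 <= m t)
    by (intros t Ht; rewrite (proj1 (Hm t Ht)); apply mu_ge_0, Ht).
  assert (DLam : forall t, I t -> is_derive_C Lam t (l t)).
  { intros t Ht; rewrite (proj1 (Hl t Ht)); apply is_derive_C_comp; split;
      [apply DLR, Ht | apply DLI, Ht]. }
  assert (DM' : forall t, I t -> is_derive M t (m t))
    by (intros t Ht; rewrite (proj1 (Hm t Ht)); apply DM, Ht).
  assert (Lam0 : Lam t0 = RtoC 0) by (unfold Lam; rewrite LR0, LI0; reflexivity).
  assert (EA : forall t, I t -> jordan_matrix l m t = A t).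
  { intros t Ht; unfold A, jordan_matrix; rewrite (proj1 (Hl t Ht)), (proj1 (Hm t Ht)); reflexivity. }
  assert (M_le : forall t s, I t -> I s -> t <= s -> M t <= M s).
  { intros t s Ht Hs Hts.
    exact (M_incr I b m M interval_lt_right interval_up m_ge DM' t s Ht Hs Hts). }
  assert (klim : forall t, I t ->
      filterlim (fun s => RInt (kernel Lam M t) t s) (to_left b) (locally (kappa t))).
  { intros t Ht.
    assert (FF := to_left_proper b t0 t0_lt_b).
    apply (filterlim_ext_loc (fun s => RInt (kappa21_integrand lambda mu t) t s));
      [| exact (kappa_lim t Ht)].
    apply filter_imp with (2 := to_left_gt b t (interval_lt_right t Ht)); intros s [H1 H2].
    apply (RInt_ext (V := R_CompleteNormedModule)); intros u.
    rewrite Rmin_left, Rmax_right by lra; intros Hu.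
    assert (Iu : I u).
    { apply interval_up with t; [exact Ht | lra |].
      apply Rbar_lt_trans with (2 := H2); apply Hu. }
    unfold kappa21_integrand, kernel.
    rewrite (HM t u Ht Iu), (HLR t u Ht Iu).
    assert (HMtu := M_le t u Ht Iu ltac:(lra)).
    rewrite Rabs_pos_eq by lra.
    f_equal; f_equal; unfold Lam, Re; simpl; ring. }
  assert (grow : filterlim (fun s => Re (Lam s)) (to_left b) (Rbar_locally p_infty)).
  { assert (FF := to_left_proper b t0 t0_lt_b).
    apply (filterlim_ext_loc (fun t => RInt (fun s => Re (lambda s)) t0 t)); [| exact growth].
    apply filter_imp with (2 := to_left_gt b t0 t0_lt_b); intros s [H1 H2].
    rewrite (HLR t0 s interval_t0), LR0; [unfold Lam, Re; simpl; ring |].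
    apply interval_up with t0; [exact interval_t0 | lra | exact H2]. }
  assert (XD := extend_within_derive lc rc a b a_lt_b).
  assert (XC := extend_continuous_on (U := C2) lc rc a b a_lt_b).
  split; [| split].
  - intros HK Hk; apply is_Ulam_constant_ext with (1 := EA).
    exact (core_upper_bound I b t0 l Lam m M kappa interval_lt_right interval_up interval_t0
             lc' mc' m_ge DLam DM' Lam0 M0 XD XC klim K HK Hk).
  - intros HU.
    assert (Cexp : forall t, I t -> continuous (fun u => exp (- Re (Lam u))) t)
      by exact (exp_opp_Lam_cont I l Lam DLam).
    assert (CM : forall t, I t -> continuous M t) by exact (M_cont I m M DM').
    destruct (primitive_on lc rc a b a_lt_b t0 (fun t => exp (- Re (Lam t)) * (1 + M t)) interval_t0)
      as [P [_ [DP _]]].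
    { apply continuous_on_of_continuous; intros t Ht.
      apply (continuous_mult (K := R_AbsRing)); [apply Cexp, Ht |].
      apply (continuous_plus (V := R_NormedModule)); [apply continuous_const | apply CM, Ht]. }
    destruct (primitive_on lc rc a b a_lt_b t0 (fun t => - exp (- Re (Lam t))) interval_t0)
      as [Q [_ [DQ _]]].
    { apply continuous_on_of_continuous; intros t Ht.
      apply (continuous_opp (V := R_NormedModule)), Cexp, Ht. }
    apply (core_lower_bound I b t0 l Lam m M kappa interval_lt_right interval_up interval_t0
             lc' mc' m_ge DLam DM' Lam0 M0 XD klim P Q K grow DP DQ).
    apply is_Ulam_constant_ext with (2 := HU).
    intros t Ht; symmetry; apply EA, Ht.
  - exact (kappa_gt_0 I b l Lam m M kappa interval_lt_right interval_up m_ge DLam DM' klim).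
Qed.

End RightEnd.

(** * Time reversal *)

(** [RInt] selects a value of the relation [is_RInt] by [iota]. Equivalent relations yield equal
    values, so the identity holds without assuming integrability. *)
Lemma RInt_reflect_opp (f : R -> R) (x y : R) :
  RInt (fun u => - f (- u)) x y = RInt f (- x) (- y).
Proof.
  apply (eq_close (V := R_NormedModule)), (close_iota (T := R_CompleteNormedModule)).
  intros l; split; intros H.
  - apply (is_RInt_ext (fun u => opp (- f (- - u)))).
    { intros u _; rewrite !Ropp_involutive; reflexivity. }
    apply (is_RInt_comp_opp (fun u => - f (- u))); rewrite !Ropp_involutive; exact H.
  - exact (is_RInt_comp_opp f x y l H).
Qed.

Lemma RInt_reflect (f : R -> R) (x y : R) :
  RInt (fun u => f (- u)) x y = RInt f (- y) (- x).
Proof.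
  apply (eq_close (V := R_NormedModule)), (close_iota (T := R_CompleteNormedModule)).
  intros l; split; intros H.
  - apply is_RInt_swap in H; apply is_RInt_opp in H; rewrite opp_opp in H.
    apply (is_RInt_ext (fun u => opp (opp (f (- - u))))).
    { intros u _; rewrite opp_opp, Ropp_involutive; reflexivity. }
    apply (is_RInt_comp_opp (fun u => opp (f (- u)))); rewrite !Ropp_involutive; exact H.
  - apply is_RInt_comp_opp, is_RInt_swap, is_RInt_opp in H; rewrite opp_opp in H.
    apply is_RInt_ext with (2 := H); intros u _; apply opp_opp.
Qed.

Definition negate_snd (v : C2) : C2 := (fst v, opp (snd v)).

Lemma norm_negate_snd (v : C2) : norm (negate_snd v) = norm v.
Proof.
  unfold norm; simpl; unfold prod_norm, negate_snd; simpl fst; simpl snd.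
  rewrite (norm_opp (V := C_R_NormedModule)); reflexivity.
Qed.

(** [negate_snd] is a linear isometry, and the remainder of the reflected function at [u] is the
    image under it of the remainder of [f] at [- u]. *)
Lemma is_derive_within_reflect (I I' : R -> Prop) (f : R -> C2) (t : R) (l : C2) :
  (forall u, I u <-> I' (- u)) -> I t -> is_derive_within I' f (- t) l ->
  is_derive_within I (fun u => negate_snd (f (- u))) t (opp (negate_snd l)).
Proof.
  intros HI Ht.
  rewrite (is_derive_within_iff I') by apply HI, Ht.
  rewrite (is_derive_within_iff I) by exact Ht.
  intros H eps; specialize (H eps).
  assert (Hopp : filterlim Ropp (locally t) (locally (- t)))
    by apply (filterlim_opp (V := R_NormedModule) t).
  generalize (Hopp _ H); unfold filtermap; apply filter_imp; intros u Hu Iu.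
  specialize (Hu (proj1 (HI u) Iu)).
  match goal with |- norm ?v <= _ =>
    replace v with
      (negate_snd (minus (minus (f (- u)) (f (- t))) (scal (minus (- u) (- t)) l))) end.
  - rewrite norm_negate_snd; apply Rle_trans with (1 := Hu); right; f_equal.
    rewrite <- (norm_opp (V := R_NormedModule) (minus u t)); f_equal.
    unfold minus, plus, opp; simpl; ring.
  - destruct (f (- u)) as [[a1 a2] [a3 a4]], (f (- t)) as [[b1 b2] [b3 b4]],
      l as [[l1 l2] [l3 l4]].
    apply injective_projections; apply injective_projections; simpl;
      unfold minus, plus, opp, scal; simpl; unfold mult; simpl;
      match goal with |- ?x = ?y => change (@eq R x y) end; ring.
Qed.

Lemma continuous_on_reflect {U V : UniformSpace} (I I' : R -> Prop) (h : U -> V) (f : R -> U) :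
  (forall u, I u <-> I' (- u)) -> (forall x, continuous h x) ->
  continuous_on I' f -> continuous_on I (fun u => h (f (- u))).
Proof.
  intros HI Hh Hf t Ht P HP.
  assert (H1 : locally (f (- t)) (fun x => P (h x))) by exact (Hh (f (- t)) P HP).
  assert (H2 : locally (- t) (fun u => I' u -> P (h (f u))))
    by exact (Hf (- t) (proj1 (HI t) Ht) _ H1).
  assert (H3 : locally t (fun u => I' (- u) -> P (h (f (- u)))))
    by exact (filterlim_opp (V := R_NormedModule) t _ H2).
  change (locally t (fun u => I u -> P (h (f (- u))))).
  apply filter_imp with (2 := H3); intros u Hu Iu; apply Hu, HI, Iu.
Qed.

(* [z(t) = (x1(-t), -x2(-t))] turns the system for [(lambda, mu)] into the one for
   [(-lambda(-t), mu(-t))]: negating the second component keeps the sign of [mu]. *)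
Lemma is_Ulam_constant_reflect (I I' : R -> Prop) (lambda lambda' : R -> C) (mu mu' : R -> R)
    (K : R) :
  (forall u, I u <-> I' (- u)) ->
  (forall u, I u -> lambda' (- u) = (- lambda u)%C /\ mu' (- u) = mu u) ->
  is_Ulam_constant I (jordan_matrix lambda mu) K ->
  is_Ulam_constant I' (jordan_matrix lambda' mu') K.
Proof.
  intros HI Hlm [HK H]; split; [exact HK |].
  assert (HI' : forall u, I' u <-> I (- u)) by (intros u; rewrite (HI (- u)), Ropp_involutive; easy).
  assert (Hlm' : forall u, I' u -> lambda' u = (- lambda (Ropp u))%C /\ mu' u = mu (- u)).
  { intros u Hu; rewrite <- (Ropp_involutive u) at 1 3; apply Hlm, HI', Hu. }
  intros eps phi dphi Heps Hphi Hdphi Hsup.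
  (* The outer [opp] in the derivative is the chain rule factor of u -> -u. *)
  destruct (H eps (fun u => negate_snd (phi (- u))) (fun u => opp (negate_snd (dphi (- u)))) Heps)
    as [x [Hx Hle]].
  - intros t Ht; apply is_derive_within_reflect with (1 := HI); [exact Ht |].
    apply Hphi, HI, Ht.
  - apply (continuous_on_reflect I I' (fun v : C2 => opp (negate_snd v))); [exact HI | | exact Hdphi].
    intros v; apply (@linear_cont R_AbsRing C2 C2).
    apply (is_linear_comp negate_snd opp); [| apply is_linear_opp].
    apply is_linear_prod; [apply is_linear_fst |].
    apply (is_linear_comp snd opp); [apply is_linear_snd | apply is_linear_opp].
  - rewrite sup_on_le in Hsup |- *; intros t Ht.
    specialize (Hsup (- t) (proj1 (HI t) Ht)).
    rewrite norm_inf_le, jordan_apply in Hsup |- *.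
    destruct (Hlm t Ht) as [-> ->] in Hsup.
    unfold negate_snd; simpl fst in *; simpl snd in *.
    destruct (phi (- t)) as [p1 p2], (dphi (- t)) as [d1 d2]; simpl fst in *; simpl snd in *.
    destruct Hsup as [H1 H2]; split.
    + rewrite <- Cmod_opp; refine (Rle_trans _ _ _ _ H1); right; f_equal.
      change (- (- d1 - (lambda t * p1 + mu t * - p2)) = d1 - (- lambda t * p1 + mu t * p2))%C; ring.
    + refine (Rle_trans _ _ _ _ H2); right; f_equal.
      change (- - d2 - lambda t * - p2 = d2 - - lambda t * p2)%C; ring.
  - exists (fun u => negate_snd (x (- u))); split.
    + intros t Ht.
      assert (D := is_derive_within_reflect I' I x t _ HI' Ht (Hx (- t) (proj1 (HI' t) Ht))).
      rewrite jordan_apply in D |- *; destruct (Hlm' t Ht) as [-> ->].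
      match type of D with is_derive_within _ _ _ ?v =>
        match goal with |- is_derive_within _ _ _ ?w => replace w with v; [exact D |] end end.
      unfold negate_snd; destruct (x (- t)) as [x1 x2]; simpl fst; simpl snd.
      change ((- (lambda (Ropp t) * x1 + mu (Ropp t) * x2), - - (lambda (Ropp t) * x2)) =
              (- lambda (Ropp t) * x1 + mu (Ropp t) * - x2, - lambda (Ropp t) * - x2))%C.
      f_equal; ring.
    + rewrite sup_on_le in Hle |- *; intros t Ht.
      specialize (Hle (- t) (proj1 (HI' t) Ht)).
      rewrite norm_inf_le in Hle |- *; rewrite Ropp_involutive in Hle.
      unfold negate_snd in *; simpl fst in *; simpl snd in *.
      destruct (phi t) as [p1 p2], (x (- t)) as [x1 x2]; simpl fst in *; simpl snd in *.
      destruct Hle as [H1 H2]; split; [exact H1 |].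
      rewrite <- Cmod_opp; refine (Rle_trans _ _ _ _ H2); right; f_equal.
      change (- (p2 - - x2) = - p2 - x2)%C; ring.
Qed.

(** * Reflection of the endpoints, and improper integrals as limits *)

Lemma interval_opp (lc rc : bool) (a b : Rbar) (t : R) :
  interval lc rc a b t <-> interval rc lc (Rbar_opp b) (Rbar_opp a) (- t).
Proof.
  unfold interval; change (Finite (- t)) with (Rbar_opp t).
  destruct lc, rc; rewrite ?Rbar_opp_le, ?Rbar_opp_lt; tauto.
Qed.

Lemma filterlim_opp_to_left (a : Rbar) :
  filterlim Ropp (to_left (Rbar_opp a)) (to_right a).
Proof.
  intros P HP.
  assert (HP' : Rbar_locally a (fun u => Rbar_lt a u -> P u)) by exact HP.
  assert (H := filterlim_Rbar_opp (Rbar_opp a)); rewrite Rbar_opp_involutive in H.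
  apply (filter_imp (F := Rbar_locally (Rbar_opp a))) with (2 := H _ HP'); intros s Hs Hlt; apply Hs.
  rewrite <- (Rbar_opp_involutive a); exact (proj2 (Rbar_opp_lt _ (Finite s)) Hlt).
Qed.

Lemma to_right_proper (a : Rbar) (t : R) : Rbar_lt a t -> ProperFilter (to_right a).
Proof.
  intros Hat; split; [| unfold to_right; apply within_filter; apply Rbar_locally_filter].
  intros P HP.
  assert (FF := to_left_proper (Rbar_opp a) (- t) (proj2 (Rbar_opp_lt t a) Hat)).
  destruct (filter_ex (fun s => P (- s)) (filterlim_opp_to_left a P HP)) as [s Hs].
  exists (- s); exact Hs.
Qed.

(** An improper integral is a limit along a product filter; [at_point] fixes one bound of
    integration, which leaves a limit of ordinary integrals in the other. *)
Lemma is_RInt_gen_to_left (b : Rbar) (t : R) (f : R -> R) (l : R) :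
  is_RInt_gen f (at_point t) (to_left b) l ->
  filterlim (fun s => RInt f t s) (to_left b) (locally l).
Proof.
  intros H P HP; destruct (H P HP) as [Q1 Q2 H1 H2 H12].
  assert (FF : Filter (to_left b)) by (apply within_filter, Rbar_locally_filter).
  apply (filter_imp (F := to_left b)) with (2 := H2); intros s Hs.
  destruct (H12 t s H1 Hs) as [y [Hy HPy]].
  rewrite (is_RInt_unique f t s y Hy); exact HPy.
Qed.

Lemma is_RInt_gen_to_right (a : Rbar) (t : R) (f : R -> R) (l : R) :
  is_RInt_gen f (to_right a) (at_point t) l ->
  filterlim (fun s => RInt f s t) (to_right a) (locally l).
Proof.
  intros H P HP; destruct (H P HP) as [Q1 Q2 H1 H2 H12].
  assert (FF : Filter (to_right a)) by (apply within_filter, Rbar_locally_filter).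
  apply (filter_imp (F := to_right a)) with (2 := H1); intros s Hs.
  destruct (H12 s t Hs H2) as [y [Hy HPy]].
  rewrite (is_RInt_unique f s t y Hy); exact HPy.
Qed.

Lemma left_end_bounds (lc rc : bool) (a b : Rbar) (lambda : R -> C) (mu kappa : R -> R) (t0 : R) :
  let I := interval lc rc a b in
  let A := jordan_matrix lambda mu in
  Rbar_lt a b -> continuous_on I lambda -> continuous_on I mu -> (forall t, I t -> 0 <= mu t) ->
  Rbar_lt a t0 -> Rbar_lt t0 b ->
  (forall t, I t ->
    filterlim (fun s => RInt (kappa22_integrand lambda mu t) s t) (to_right a) (locally (kappa t))) ->
  filterlim (fun t => RInt (fun s => Re (lambda s)) t t0) (to_right a) (Rbar_locally m_infty) ->
  forall K : R,
  (0 < K -> (forall t, I t -> kappa t <= K) -> is_Ulam_constant I A K) /\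
  (is_Ulam_constant I A K -> forall t, I t -> kappa t <= K) /\
  (forall t, I t -> 0 < kappa t).
Proof.
  intros I A Hab Cl Cm Hm Ha Hb Hk Hg K.
  set (I' := interval rc lc (Rbar_opp b) (Rbar_opp a)).
  set (lambda' := fun t => (- lambda (Ropp t))%C).
  set (mu' := fun t => mu (- t)).
  assert (HI : forall u, I u <-> I' (- u)) by apply interval_opp.
  assert (HI' : forall u, I' u <-> I (- u)) by (intros u; rewrite (HI (- u)), Ropp_involutive; easy).
  assert (Hab' : Rbar_lt (Rbar_opp b) (Rbar_opp a)) by (apply Rbar_opp_lt, Hab).
  assert (Hb' : Rbar_lt (Rbar_opp b) (- t0)) by (apply (Rbar_opp_lt b t0), Hb).
  assert (Ha' : Rbar_lt (- t0) (Rbar_opp a)) by (apply (Rbar_opp_lt t0 a), Ha).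
  assert (I't0 : I' (- t0)) by exact (interval_interior rc lc _ _ _ Hb' Ha').
  assert (Cl' : continuous_on I' lambda').
  { apply (continuous_on_reflect I' I Copp); [exact HI' | | exact Cl].
    intros z; exact (@linear_cont R_AbsRing C_R_NormedModule C_R_NormedModule opp z is_linear_opp). }
  assert (Cm' : continuous_on I' mu').
  { apply (continuous_on_reflect I' I (fun x : R => x)); [exact HI' | | exact Cm].
    intros x; apply continuous_id. }
  assert (FF := to_left_proper _ _ Ha').
  (* The primitive is used to reverse the orientation of integrals of Re lambda between points of
     [I]. *)
  destruct (primitive_on lc rc a b Hab t0 (fun s => Re (lambda s))) as [F [_ [_ HF]]].
  { apply (interval_interior lc rc a b t0 Ha Hb). }
  { apply continuous_on_Re, Cl. }
  assert (Ere : forall t s, RInt (fun u => Re (lambda' u)) t s = RInt (fun u => Re (lambda u)) (- t) (- s)).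
  { intros t s; exact (RInt_reflect_opp (fun u => Re (lambda u)) t s). }
  (* The integrals of Re lambda' from t to u and of Re lambda from -u to -t are opposite, those of
     mu' and mu are equal: this turns the decaying weight of the first case into that of the
     second. *)
  assert (Ek : forall t u, I' t -> I' u ->
      kappa21_integrand lambda' mu' t u = kappa22_integrand lambda mu (- t) (- u)).
  { intros t u Ht Hu; unfold kappa21_integrand, kappa22_integrand.
    rewrite Ere, !HF by (apply HI'; assumption).
    unfold mu'; rewrite RInt_reflect; f_equal; f_equal; ring. }
  assert (Hev : to_left (Rbar_opp a) (fun s => I' s)).
  { apply filter_imp with (2 := to_left_gt _ _ Ha'); intros s [Hs1 Hs2].
    exact (interval_up rc lc _ _ (- t0) s I't0 (Rlt_le _ _ Hs1) Hs2). }
  destruct (right_end_bounds rc lc (Rbar_opp b) (Rbar_opp a) lambda' mu' (fun t => kappa (- t)) (- t0)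
              Hab' Cl' Cm') with (K := K) as [H1 [H2 H3]]; [| exact Hb' | exact Ha' | | |].
  - intros t Ht; apply Hm, HI', Ht.
  - intros t Ht.
    apply (filterlim_ext_loc (fun s => RInt (kappa22_integrand lambda mu (- t)) (- s) (- t))).
    + apply filter_imp with (2 := Hev); intros s Hs.
      rewrite <- RInt_reflect.
      apply (RInt_ext (V := R_CompleteNormedModule)); intros u Hu; symmetry; apply Ek; [exact Ht |].
      apply (interval_between_minmax rc lc (Rbar_opp b) (Rbar_opp a) t u s Ht Hs); lra.
    + exact (filterlim_comp _ _ _ Ropp _ _ _ _ (filterlim_opp_to_left a)
               (Hk (- t) (proj1 (HI' t) Ht))).
  - apply (filterlim_ext_loc (fun s => - RInt (fun u => Re (lambda u)) (- s) t0)).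
    + apply filter_imp with (2 := Hev); intros s Hs.
      rewrite Ere, Ropp_involutive, !HF;
        try (apply HI'; assumption); try (apply (interval_interior lc rc a b t0 Ha Hb)).
      ring.
    + exact (filterlim_comp _ _ _ _ Ropp _ _ _
               (filterlim_comp _ _ _ Ropp _ _ _ _ (filterlim_opp_to_left a) Hg)
               (filterlim_Rbar_opp m_infty)).
  - assert (EI : forall t, I t -> kappa t = kappa (- - t) /\ I' (- t)).
    { intros t Ht; rewrite Ropp_involutive; split; [reflexivity | apply HI, Ht]. }
    split; [| split].
    + intros HK Hle.
      apply (is_Ulam_constant_reflect I' I lambda' lambda mu' mu K HI').
      * intros u _; split; [| reflexivity].
        unfold lambda'; destruct (lambda (Ropp u)); unfold Copp; simpl; rewrite !Ropp_involutive; reflexivity.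
      * apply H1; [exact HK | intros t Ht; apply Hle, HI', Ht].
    + intros HU t Ht; destruct (EI t Ht) as [-> Ht']; refine (H2 _ (- t) Ht').
      apply (is_Ulam_constant_reflect I I' lambda lambda' mu mu' K HI); [| exact HU].
      intros u _; unfold lambda', mu'; rewrite Ropp_involutive; split; reflexivity.
    + intros t Ht; destruct (EI t Ht) as [-> Ht']; exact (H3 (- t) Ht').
Qed.

(** * From bounds to the best constant *)

Lemma best_Ulam_constant_of_bounds (I : R -> Prop) (A : R -> @matrix C 2 2) (kappa : R -> R) (t0 : R) :
  I t0 -> Rbar_lt (sup_on I kappa) p_infty ->
  (forall K : R,
    (0 < K -> (forall t, I t -> kappa t <= K) -> is_Ulam_constant I A K) /\
    (is_Ulam_constant I A K -> forall t, I t -> kappa t <= K) /\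
    (forall t, I t -> 0 < kappa t)) ->
  Ulam_stable I A /\ is_best_Ulam_constant I A (real (sup_on I kappa)).
Proof.
  intros Ht0 Hsup HK.
  assert (Hub : forall t, I t -> Rbar_le (kappa t) (sup_on I kappa)).
  { intros t Ht; apply (proj1 (Lub_Rbar_correct _)); exists t; easy. }
  assert (H0 := Hub t0 Ht0).
  (* The supremum is not [p_infty] by hypothesis, and not [m_infty] because it is at least
     [kappa t0]. *)
  destruct (sup_on I kappa) as [S | |] eqn:ES; [simpl | easy | easy].
  (* Positivity of [kappa] does not mention [K], so [0] is an arbitrary instance. *)
  assert (Hpos := proj2 (proj2 (HK 0)) t0 Ht0).
  assert (HU : is_Ulam_constant I A S).
  { apply HK; [simpl in H0; lra | exact Hub]. }
  split; [exists S; exact HU | split; [exact HU |]].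
  intros K' HK'.
  change (Rbar_le S K'); rewrite <- ES, sup_on_le.
  apply HK, HK'.
Qed.

Theorem theorem4p3 (a b : Rbar) (lc rc : bool) (lambda : R -> C) (mu : R -> R) (t0 : R) :
  let I := interval lc rc a b in
  let A := jordan_matrix lambda mu in
  Rbar_lt a b ->
  continuous_on I lambda ->
  continuous_on I mu ->
  (forall t, I t -> 0 <= mu t) ->
  Rbar_lt a t0 -> Rbar_lt t0 b ->
  ((forall t, I t ->
      ex_RInt_gen (kappa21_integrand lambda mu t) (at_point t) (to_left b)) ->
   Rbar_lt (sup_on I (kappa21 b lambda mu)) p_infty ->
   filterlim (fun t => RInt (fun s => Re (lambda s)) t0 t)
     (to_left b) (Rbar_locally p_infty) ->
   Ulam_stable I A /\
   is_best_Ulam_constant I A (real (sup_on I (kappa21 b lambda mu))))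
  /\
  ((forall t, I t ->
      ex_RInt_gen (kappa22_integrand lambda mu t) (to_right a) (at_point t)) ->
   Rbar_lt (sup_on I (kappa22 a lambda mu)) p_infty ->
   filterlim (fun t => RInt (fun s => Re (lambda s)) t t0)
     (to_right a) (Rbar_locally m_infty) ->
   Ulam_stable I A /\
   is_best_Ulam_constant I A (real (sup_on I (kappa22 a lambda mu)))).
Proof.
  intros I A Hab Cl Cm Hm Ha Hb.
  assert (It0 : I t0) by exact (interval_interior lc rc a b t0 Ha Hb).
  (* Properness of the endpoint filters makes the value of an improper integral unique, so that
     [RInt_gen] is the limit whenever the integral exists. *)
  assert (FL := to_left_proper b t0 Hb).
  assert (FR := to_right_proper a t0 Ha).
  split; intros Hex Hsup Hg; apply best_Ulam_constant_of_bounds with t0; try assumption.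
  - apply (right_end_bounds lc rc a b lambda mu (kappa21 b lambda mu) t0); try assumption.
    intros t Ht; apply is_RInt_gen_to_left.
    apply (RInt_gen_correct (V := R_CompleteNormedModule)), Hex, Ht.
  - apply (left_end_bounds lc rc a b lambda mu (kappa22 a lambda mu) t0); try assumption.
    intros t Ht; apply is_RInt_gen_to_right.
    apply (RInt_gen_correct (V := R_CompleteNormedModule)), Hex, Ht.
Qed.
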